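(* Every triangle-free graph on $n$ vertices has at most $3^{n/3}$ maximal induced matchings. Moreover, this bound is attained by every graph that is a disjoint union of copies of the complete bipartite graph $K_{3,3}$.
   Context: All graphs are finite, simple and undirected. A matching in a graph $G$ is a set $M\subseteq E(G)$ of edges no two of which share an endpoint. A matching $M$ is induced if the subgraph of $G$ induced by the set of endpoints of edges of $M$ is $1$-regular (i.e., no edge of $G$ joins endpoints of two distinct edges of $M$). An induced matching $M$ is maximal if there is no induced matching $M'$ of $G$ with $M\subsetneq M'$. *)

(* Defs.v *)
From HB Require Import structures.
From mathcomp Require Import all_boot all_order all_algebra.
From mathcomp Require Import reals exp.

Set Implicit Arguments.
Unset Strict Implicit.
Unset Printing Implicit Defensive.

Record sgraph := SGraph {
  vertex :> finType;
  adj : rel vertex;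
  adj_sym : symmetric adj;
  adj_irrefl : irreflexive adj
}.

Definition triangle_free (G : sgraph) : Prop :=
  forall x y z : G, ~~ [&& adj x y, adj y z & adj x z].

Definition edges (G : sgraph) : {set {set G}} :=
  [set [set p.1; p.2] | p : G * G & adj p.1 p.2].

Definition matching (G : sgraph) (M : {set {set G}}) : bool :=
  (M \subset edges G) && trivIset M.

(* [cover M] is the set of endpoints of the edges of [M]; the second conjunct
   says that the subgraph it induces is 1-regular. *)
Definition induced_matching (G : sgraph) (M : {set {set G}}) : bool :=
  matching M && [forall x in cover M, #|[set y in cover M | adj x y]| == 1].

Definition maximal_induced_matchings (G : sgraph) : {set {set {set G}}} :=
  [set M | maxset (@induced_matching G) M].

Definition isomorphic (G H : sgraph) : Prop :=
  exists2 f : G -> H, bijective f & {mono f : x y / adj x y}.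

Section CompleteBipartite.
Variables m n : nat.

Definition Kmn_adj : rel ('I_m + 'I_n) := fun x y =>
  match x, y with
  | inl _, inr _ | inr _, inl _ => true
  | _, _ => false
  end.

Fact Kmn_sym : symmetric Kmn_adj. Proof. by case=> ? [] ?. Qed.
Fact Kmn_irrefl : irreflexive Kmn_adj. Proof. by case. Qed.

Definition complete_bipartite : sgraph := SGraph Kmn_sym Kmn_irrefl.
End CompleteBipartite.

Section DisjointCopies.
Variables (k : nat) (H : sgraph).

Definition copies_adj : rel ('I_k * H) := fun x y =>
  (x.1 == y.1) && adj x.2 y.2.

Fact copies_sym : symmetric copies_adj.
Proof. by move=> x y; rewrite /copies_adj eq_sym adj_sym. Qed.
Fact copies_irrefl : irreflexive copies_adj.
Proof. by move=> x; rewrite /copies_adj adj_irrefl andbF. Qed.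

Definition disjoint_copies : sgraph := SGraph copies_sym copies_irrefl.
End DisjointCopies.

(* Main.v *)
Require Import Defs.
From HB Require Import structures.
From mathcomp Require Import all_boot all_order all_fingroup all_algebra.
From mathcomp Require Import reals exp ring lra zify.

Set Implicit Arguments.
Unset Strict Implicit.
Unset Printing Implicit Defensive.

Import Order.TTheory GRing.Theory Num.Theory.

(* A maximal induced matching is determined by the set W of its endpoints, and
   the sets W that arise are those inducing a 1-regular graph whose
   neighbourhood meets every edge.

   Symmetrization: let u, v be non-adjacent with different neighbourhoods and
   suppose that no induced matching covers both.  Turning all twins of u into
   twins of v, or conversely, does not decrease the number of maximal induced
   matchings and lowers the number of twin classes.  Hence in a minimal
   counterexample such u, v always have private neighbours u', v' with
   {uu', vv'} an induced matching ([separated]).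

   Branching: with t = 3^(-1/3), rho Z is the number of maximal induced
   matchings avoiding the vertices Z, times t^n.  Those that use an edge xy are
   maximal induced matchings of G - N(x) - N(y) - Z, which in a triangle-free
   graph loses deg x + deg y + (number of vertices of Z not adjacent to x, y)
   vertices.  One deletes vertices in turn, paying for the edges used at each of
   them, until Z contains N(u) and N(v) for some edge uv: then rho Z = 0, by
   maximality.  The cases are minimum degree 1, 2, and at least 3; in the last
   one a vertex of degree at least 4 makes the first branching step sufficient,
   and cubic graphs are treated according to the 4-cycles through a vertex. *)

(** * Maximal induced matchings as vertex sets *)

(** The obstacle is that $K_{3,3}$ attains the bound, so the branching may lose nothing there: its
    nine edges, each of weight [t ^+ 6] = 1/9, sum to exactly 1. Deleting a single vertex of a cubic
    graph and applying induction to the rest only gives [t + 3 * t ^+ 6], about 1.027; this is why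
    the branching must go on until some edge can no longer be dominated. Separation supplies the
    structure for this. If N(u) is contained in N(v) and u is not isolated, then u has no private
    neighbour, so u and v are twins. Around a vertex of degree 1 or 2 this produces whole sets of
    twins, and in cubic graphs it excludes adjacencies around a 4-cycle. Because [t ^+ 3] = 1/3,
    every power of [t] is a rational multiple of 1, [t] or [t ^+ 2], so each concrete case ends in
    an inequality linear in [t] and [t ^+ 2], decided by rational upper bounds for these two. The
    margins are often below two percent; where a generic estimate exceeds 1, the case is split
    further. *)

Section Mims.
Variable V : finType.
Implicit Types (e : rel V) (W Z : {set V}) (x y z u v w : V).

(** A loop at [x] counts as the triangle [x], [x], [x], so irreflexivity is part of this notion. *)
Definition trifree e := symmetric e /\ forall x y z, e x y -> e y z -> e x z = false.

Definition nbr e x : {set V} := [set y | e x y].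
Definition deg e x := #|nbr e x|.
(* Vertices are deleted by isolating them ([del]), so that all graphs live on V;
   the number of non-isolated vertices plays the role of n. *)
Definition active e : {set V} := [set x | [exists y, e x y]].

Definition one_regular e W := [forall x in W, #|[set y in W | e x y]| == 1].
(** Maximality in terms of vertices. Open neighbourhoods suffice: an endpoint of the edge that lies
    in [W] is itself adjacent to its partner in [W]. *)
Definition edge_dominating e W :=
  [forall u, forall v, e u v ==> [exists w in W, e u w || e v w]].
Definition mims e : {set {set V}} :=
  [set W | one_regular e W && edge_dominating e W].

Definition del e Z : rel V := fun x y => [&& x \notin Z, y \notin Z & e x y].

Lemma one_regularP e W :
  reflect (forall x, x \in W -> exists2 y, y \in W &
             e x y /\ forall z, z \in W -> e x z -> z = y)
          (one_regular e W).
Proof.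
apply: (iffP forall_inP) => h x xW.
  have /cards1P [y hy] := h x xW.
  have := set11 y; rewrite -hy inE => /andP [yW exy].
  exists y => //; split=> // z zW exz.
  by apply/set1P; rewrite -hy inE zW.
have [y yW [exy uy]] := h x xW.
apply/cards1P; exists y; apply/setP => z; rewrite !inE.
apply/andP/eqP => [[zW exz]|->//]; exact: uy.
Qed.

Lemma edge_dominatingP e W :
  reflect (forall u v, e u v -> exists2 w, w \in W & e u w || e v w)
          (edge_dominating e W).
Proof.
apply: (iffP forallP) => [h u v euv|h u].
  by have /forallP /(_ v) /implyP /(_ euv) /exists_inP := h u.
by apply/forallP => v; apply/implyP => /h /exists_inP.
Qed.

Lemma mimsP e W : reflect
  ((forall x, x \in W -> exists2 y, y \in W &
             e x y /\ forall z, z \in W -> e x z -> z = y) /\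
   (forall u v, e u v -> exists2 w, w \in W & e u w || e v w))
  (W \in mims e).
Proof.
rewrite inE; apply: (iffP andP) => -[h1 h2]; split.
- exact/one_regularP. - exact/edge_dominatingP.
- exact/one_regularP. - exact/edge_dominatingP.
Qed.

Lemma mim_partner e W x : W \in mims e -> x \in W -> exists2 y, y \in W & e x y.
Proof. by move=> /mimsP [h _] /h [y yW [exy _]]; exists y. Qed.

Lemma mim_inj e W x y z : W \in mims e -> x \in W -> y \in W -> z \in W ->
  e x y -> e x z -> y = z.
Proof.
by move=> /mimsP [h _] /h [a aW [_ ua]] yW zW /ua -> // /ua ->.
Qed.

Lemma mim_dom e W u v : W \in mims e -> e u v ->
  exists2 w, w \in W & e u w || e v w.
Proof. by move=> /mimsP [_ h] /h. Qed.

Lemma trifree_irr e x : trifree e -> e x x = false.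
Proof. by move=> [_ h]; case exx: (e x x) => //; rewrite -exx; apply: (h x x x). Qed.

Lemma trifree_del e Z : trifree e -> trifree (del e Z).
Proof.
move=> [s t]; split=> [x y|x y z]; first by rewrite /del s andbCA.
move=> /and3P [_ _ exy] /and3P [_ _ eyz].
by rewrite /del (t _ _ _ exy eyz) !andbF.
Qed.

Lemma active_del e Z : active (del e Z) \subset active e :\: Z.
Proof.
apply/subsetP => x; rewrite !inE => /existsP [y /and3P [-> _ exy]].
by apply/existsP; exists y.
Qed.

Lemma deg_gt0 e x : (0 < deg e x) = (x \in active e).
Proof.
rewrite /deg card_gt0 inE.
apply/set0Pn/existsP => -[y hy]; exists y; by move: hy; rewrite ?inE.
Qed.

Lemma mim_del e Z W : W \in mims e -> [disjoint W & Z] -> W \in mims (del e Z).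
Proof.
move=> /mimsP [h1 h2] dWZ; have nZ x : x \in W -> x \notin Z.
  by move=> xW; rewrite (disjointFr dWZ).
apply/mimsP; split.
  move=> x xW; have [y yW [exy uy]] := h1 x xW; exists y => //.
  split; first by rewrite /del !nZ.
  by move=> z zW /and3P [_ _]; apply: uy.
move=> u v /and3P [uZ vZ /h2 [w wW hw]]; exists w => //.
by rewrite /del uZ vZ nZ.
Qed.

(** No other vertex of [W] is adjacent to [x] or [y], so all of them survive the deletion along with
    their partners. An edge dominated by [x] or [y] has a deleted endpoint, so the surviving edges
    are dominated from the rest of [W]. *)
Lemma mim_edge e W x y : trifree e -> W \in mims e -> x \in W -> y \in W -> e x y ->
  W :\ x :\ y \in mims (del e (nbr e x :|: nbr e y)).
Proof.
move=> [sym tri] mW xW yW exy.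
have eyx : e y x by rewrite sym.
have nN z : z \in W :\ x :\ y -> z \notin nbr e x :|: nbr e y.
  rewrite !inE => /and3P [zy zx zW]; apply/norP; split; apply/negP => h.
    by move/eqP: zy; apply; apply: (mim_inj mW xW).
  by move/eqP: zx; apply; apply: (mim_inj mW yW).
apply/mimsP; split.
  move=> z zW'; move: (zW'); rewrite !inE => /and3P [zy zx zW].
  have [w wW ezw] := mim_partner mW zW.
  have wW' : w \in W :\ x :\ y.
    have := nN _ zW'; rewrite !inE => /norP [exz eyz].
    rewrite wW andbT; apply/andP; split; apply/eqP => E; subst w.
      by rewrite sym ezw in eyz.
    by rewrite sym ezw in exz.
  exists w => //; split; first by rewrite /del !nN.
  move=> w'; rewrite !inE => /and3P [_ _ w'W] /and3P [_ _ ezw'].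
  exact: (mim_inj mW zW).
move=> u v /and3P [uN vN euv]; have [w wW hw] := mim_dom mW euv.
have wW' : w \in W :\ x :\ y.
  move: uN vN; rewrite !inE => /norP [a b] /norP [c d].
  rewrite wW andbT; apply/andP; split; apply/eqP => E; subst w; move: hw;
  by rewrite sym [e v _]sym ?(negPf a) ?(negPf b) ?(negPf c) ?(negPf d).
exists w => //; rewrite /del uN vN nN //=.
Qed.

End Mims.

Lemma mims_preim (V V' : finType) (e : rel V) (e' : rel V') (g : V -> V') W :
  bijective g -> (forall x y, e' (g x) (g y) = e x y) ->
  W \in mims e' -> g @^-1: W \in mims e.
Proof.
move=> [h gK hK] mono mW; apply/mimsP; split.
  move=> x; rewrite inE => xW; have [y yW exy] := mim_partner mW xW.
  exists (h y); first by rewrite inE hK.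
  split; first by rewrite -mono hK.
  move=> z; rewrite inE => zW; rewrite -mono => exz.
  by apply: (can_inj gK); rewrite hK; apply: (mim_inj mW xW).
move=> u v; rewrite -mono => /(mim_dom mW) [w wW hw].
by exists (h w); rewrite ?inE ?hK // -!mono hK.
Qed.

(** * Twin classes and symmetrization *)

Section Twins.
Variable V : finType.
Implicit Types (e : rel V) (W Z C : {set V}) (x y z u v w : V).

Lemma nbr_eq e x y z : nbr e x = nbr e y -> e x z = e y z.
Proof. by move=> txy; have := erefl (z \in nbr e x); rewrite {2}txy !inE. Qed.

Definition cov e x := #|[set W in mims e | x \in W]|.

(** The transposition of two twins is an automorphism; it carries the sets covering [x] injectively
    to sets covering [y]. *)
Lemma cov_twin_le e x y : trifree e -> nbr e x = nbr e y -> cov e x <= cov e y.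
Proof.
move=> [sym _] txy; have tE z := nbr_eq z txy.
have mono a b : e (tperm x y a) (tperm x y b) = e a b.
  have h c d : e (tperm x y c) d = e c d.
    by case: tpermP => // ->.
  by rewrite h sym h sym.
have bij : bijective (tperm x y) by exists (tperm x y); apply: tpermK.
pose sw (W : {set V}) := tperm x y @^-1: W.
have sK : cancel sw sw by move=> W; apply/setP => z; rewrite !inE tpermK.
rewrite /cov -(card_imset _ (can_inj sK)).
apply/subset_leq_card/subsetP => _ /imsetP [W /setIdP [mW xW] ->].
by apply/setIdP; split; [exact: mims_preim mW | rewrite inE tpermR].
Qed.

Lemma mim_twins e W x y : W \in mims e -> x \in W -> y \in W ->
  symmetric e -> nbr e x = nbr e y -> x = y.
Proof.
move=> mW xW yW sym txy; have [z zW exz] := mim_partner mW xW.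
have eyz : e y z by rewrite -(nbr_eq z txy).
by apply: (mim_inj mW zW xW yW); rewrite sym.
Qed.

(** Two twins in [W] would share a partner. Hence [W] meets a set [C] of twins in at most one
    vertex, and the count splits accordingly. *)
Lemma card_mims_twins e C u : symmetric e -> {in C, forall x, nbr e x = nbr e u} ->
  #|mims e| = #|[set W in mims e | [disjoint W & C]]| + \sum_(x in C) cov e x.
Proof.
move=> sym tC; rewrite -sum1_card.
under eq_bigr => W mW.
  have -> : 1 = [disjoint W & C] + \sum_(x in C) (x \in W).
    case: (boolP [disjoint W & C]) => [d|].
      by rewrite big1 // => x xC; rewrite (disjointFl d).
    rewrite -setI_eq0 => /set0Pn [x]; rewrite inE => /andP [xW xC].
    rewrite (bigD1 x) //= xW big1 // => y /andP [yC yx].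
    apply/eqP; rewrite eqb0; apply/negP => yW; move/eqP: yx; apply.
    by apply: (mim_twins mW yW xW sym); rewrite !tC.
  over.
rewrite big_split /= exchange_big /=; congr (_ + _).
  by rewrite -sum1dep_card [RHS]big_mkcondr; apply: eq_bigr => W _; case: ifP.
apply: eq_bigr => x _; rewrite /cov -sum1dep_card [RHS]big_mkcondr.
by apply: eq_bigr => W _; case: ifP.
Qed.

(** The relation is pulled back along a map sending the twin class of [u] to [v]: every twin of [u]
    becomes a copy of [v], while the vertex type stays fixed. *)
Definition merge e u v : rel V :=
  let phi x := if nbr e x == nbr e u then v else x in
  fun x y => e (phi x) (phi y).

Definition twin_classes e := #|[set nbr e x | x : V]|.

Lemma trifree_merge e u v : trifree e -> trifree (merge e u v).
Proof.
move=> [sym tri]; split=> [x y|x y z]; first by rewrite /merge sym.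
exact: tri.
Qed.

Lemma active_twin e x y : nbr e x = nbr e y -> (x \in active e) = (y \in active e).
Proof. by move=> h; rewrite -!deg_gt0 /deg h. Qed.

Lemma active_merge e u v : u \in active e -> v \in active e ->
  active (merge e u v) \subset active e.
Proof.
move=> us vs; apply/subsetP => x; rewrite inE => /existsP [y].
rewrite /merge; case: (nbr e x =P nbr e u) => [/active_twin -> //|_].
by case: ifP => _ h; rewrite inE; apply/existsP; eexists; exact: h.
Qed.

(** Each neighbourhood of the merged graph is the preimage under [phi] of a neighbourhood of [e]
    other than that of [u]. *)
Lemma twin_classes_merge e u v : nbr e u != nbr e v -> twin_classes (merge e u v) < twin_classes e.
Proof.
move=> uv; pose phi x := if nbr e x == nbr e u then v else x.
have sub : [set nbr (merge e u v) x | x : V] \subset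
    [set phi @^-1: N | N : {set V} in [set nbr e x | x : V] :\ nbr e u].
  apply/subsetP => _ /imsetP [x _ ->]; apply/imsetP; exists (nbr e (phi x)).
    rewrite !inE imset_f // andbT /phi.
    by case: ifP => [_|->//]; rewrite eq_sym.
  by apply/setP => y; rewrite !inE.
apply: (leq_ltn_trans (subset_leq_card sub)).
apply: (leq_ltn_trans (leq_imset_card _ _)).
by rewrite /twin_classes [in X in _ < X](cardsD1 (nbr e u)) imset_f.
Qed.

(** Both counts are split along the twin class [C] of [u]. Sets avoiding [C] survive, since [phi]
    fixes them pointwise. A vertex of [C] was covered at most [cov e u] times; afterwards it is a
    twin of [v] and is covered at least [cov e v] times, because the sets covering [v] avoid [C] by
    hypothesis and therefore survive. *)
Lemma card_mims_merge e u v : trifree e -> nbr e u != nbr e v ->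
  (forall W x, W \in mims e -> x \in W -> v \in W -> nbr e x != nbr e u) ->
  cov e u <= cov e v -> #|mims e| <= #|mims (merge e u v)|.
Proof.
move=> ge uv dis cle; have [sym tri] := ge.
have [sym' tri'] := trifree_merge u v ge.
pose phi x := if nbr e x == nbr e u then v else x.
pose C := [set x | nbr e x == nbr e u].
have phiC x : x \notin C -> phi x = x by rewrite inE /phi => /negPf ->.
have phiv : phi v = v by rewrite /phi; case: ifP.
have sub W : W \in mims e -> [disjoint W & C] -> W \in mims (merge e u v).
  move=> mW d; have hp x : x \in W -> phi x = x.
    by move=> xW; rewrite phiC // (disjointFr d).
  have hpw x w : w \in W -> merge e u v x w = e (phi x) w.
    by move=> wW; rewrite /merge -/(phi _) -/(phi _) (hp w).
  apply/mimsP; split.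
    move=> x xW; have [y yW exy] := mim_partner mW xW.
    exists y => //; rewrite hpw // hp //; split=> // z zW.
    by rewrite hpw // hp // => exz; apply: (mim_inj mW xW).
  move=> a b eab; have [w wW hw] := mim_dom mW (eab : e (phi a) (phi b)).
  by exists w => //; rewrite !hpw.
have tw x : x \in C -> nbr (merge e u v) x = nbr (merge e u v) v.
  rewrite inE => /eqP hx; apply/setP => y; rewrite !inE /merge -/(phi _) -/(phi _) -/(phi _).
  by rewrite phiv {1}/phi hx eqxx.
rewrite (@card_mims_twins e C u) //; last by move=> x; rewrite inE => /eqP.
rewrite (@card_mims_twins (merge e u v) C v) //.
apply: leq_add.
  apply/subset_leq_card/subsetP => W /setIdP [mW d].
  by apply/setIdP; split; [exact: sub|].
apply: leq_sum => x xC.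
have h1 : cov e x <= cov e u by apply: cov_twin_le => //; move: xC; rewrite inE => /eqP.
have h2 : cov (merge e u v) v <= cov (merge e u v) x.
  by apply: cov_twin_le; [apply: trifree_merge|rewrite tw].
apply: leq_trans h2; apply: (leq_trans h1); apply: (leq_trans cle).
apply/subset_leq_card/subsetP => W /setIdP [mW vW]; apply/setIdP; split=> //.
apply: sub => //; rewrite disjoint_subset; apply/subsetP => w wW.
by rewrite !inE (dis W).
Qed.

End Twins.

(** * The dichotomy between separation and merging *)

Section Separated.
Variable V : finType.
Implicit Types (e : rel V).

Definition separated e := forall u v, u \in active e -> v \in active e ->
  e u v = false -> nbr e u <> nbr e v ->
  exists u' v', [/\ e u u', e v v', e u v' = false, e v u' = false & e u' v' = false].

(** If [u] and [v] lack the required private neighbours, no maximal induced matching covers a twin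
    of each, as the two partners would be such neighbours. The class covered less often is then
    merged into the other. *)
Lemma separated_or_merge e : trifree e -> separated e \/
  exists e', [/\ trifree e', #|active e'| <= #|active e|, twin_classes e' < twin_classes e &
                 #|mims e| <= #|mims e'|].
Proof.
move=> ge; have [sym tri] := ge.
pose good u v := [exists u', exists v',
  [&& e u u', e v v', ~~ e u v', ~~ e v u' & ~~ e u' v']].
case: (boolP [forall u in active e, forall v in active e,
  ~~ e u v ==> (nbr e u != nbr e v) ==> good u v]) => [h|].
  left=> u v us vs /negbT euv /eqP uv.
  have /forall_inP /(_ v vs) := forall_inP h u us.
  rewrite euv uv !implyTb => /existsP [u' /existsP [v' /and5P [a b c d f]]].
  by exists u', v'; split=> //; apply: negPf.
rewrite negb_forall_in => /exists_inP [u us].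
rewrite negb_forall_in => /exists_inP [v vs].
rewrite 2!negb_imply => /and3P [euv uv bad]; right.
have dis W x y : W \in mims e -> x \in W -> y \in W ->
    nbr e x = nbr e u -> nbr e y = nbr e v -> False.
  move=> mW xW yW xu yv; have xE z := nbr_eq z xu; have yE z := nbr_eq z yv.
  have xy : x != y by apply: contraNneq uv => E; rewrite -xu -yv E.
  have [x' x'W exx'] := mim_partner mW xW; have [y' y'W eyy'] := mim_partner mW yW.
  have nxy' : ~~ e x y'.
    apply: contraNN xy => h; apply/eqP; apply: (mim_inj mW y'W xW yW); by rewrite sym.
  have nyx' : ~~ e y x'.
    apply: contraNN xy => h; apply/eqP; apply: (mim_inj mW x'W xW yW); by rewrite sym.
  move/negP: bad; apply; apply/existsP; exists x'; apply/existsP; exists y'.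
  rewrite -!xE -!yE exx' eyy' nxy' nyx' /=; apply: contraNN euv => h.
  have E : x = y' by apply: (mim_inj mW x'W xW y'W) => //; rewrite sym.
  by rewrite -xE sym -yE E.
case: (leqP (cov e u) (cov e v)) => hc.
  exists (merge e u v); split; [exact: trifree_merge| | exact: twin_classes_merge|].
    exact/subset_leq_card/active_merge.
  by apply: card_mims_merge => // W x mW xW vW; apply/eqP => xu; apply: (dis W x v).
rewrite eq_sym in uv.
exists (merge e v u); split; [exact: trifree_merge| | exact: twin_classes_merge|].
  exact/subset_leq_card/active_merge.
apply: card_mims_merge => // [W x mW xW vW|]; last exact: ltnW.
by apply/eqP => xu; apply: (dis W u x).
Qed.

End Separated.

Local Open Scope ring_scope.

(** * Powers of the cube root of 1/3 *)

Section CubeRoot.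
Variables (R : realFieldType) (t : R).
Hypotheses (t_gt0 : 0 < t) (t3 : t ^+ 3 = 3^-1).

(* 303/437 and 25/52 are continued fraction approximations from above of t and
   t^2. *)
Lemma t_hi : t < 303 / 437.
Proof.
rewrite ltNge; apply/negP => h; have h1 : 303 <= 437 * t by lra.
set s := 437 * t in h1.
have h2 : 303 * 303 <= s * s by apply: ler_pM => //; lra.
have h3 : 303 * 303 * 303 <= s * s * s by apply: ler_pM => //; lra.
have E : s * s * s = 437 * 437 * 437 * t ^+ 3 by rewrite /s; ring.
by rewrite E t3 in h3; lra.
Qed.

Lemma t2_hi : t ^+ 2 < 25 / 52.
Proof. by have := t_hi; have := t_gt0; nra. Qed.

Lemma t4 : t ^+ 4 = t / 3. Proof. by rewrite (exprD t 3 1) t3 mulrC. Qed.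
Lemma t5 : t ^+ 5 = t ^+ 2 / 3. Proof. by rewrite (exprD t 3 2) t3 mulrC. Qed.
Lemma t6 : t ^+ 6 = 9^-1. Proof. by rewrite (exprM t 3 2) t3; lra. Qed.
Lemma t7 : t ^+ 7 = t / 9. Proof. by rewrite (exprD t 6 1) t6 mulrC. Qed.
Lemma t8 : t ^+ 8 = t ^+ 2 / 9. Proof. by rewrite (exprD t 6 2) t6 mulrC. Qed.
Lemma t9 : t ^+ 9 = 27^-1. Proof. by rewrite (exprM t 3 3) t3; lra. Qed.
Lemma t10 : t ^+ 10 = t / 27. Proof. by rewrite (exprD t 9 1) t9 mulrC. Qed.

Lemma t_le1 : t <= 1. Proof. by have := t_hi; lra. Qed.

Lemma t_mono m n : (m <= n)%N -> t ^+ n <= t ^+ m.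
Proof. by move=> mn; apply: ler_wiXn2l => //; [exact: ltW | exact: t_le1]. Qed.

(** Equality holds at [n] = 3. From there on the ratio [(n + 1) * t / n] of consecutive terms is
    below 1; the earlier values are checked directly. *)
Lemma nt_le1 n : n%:R * t ^+ n <= 1.
Proof.
elim: n => [|n IH]; first by rewrite mul0r.
have := t_hi; have := t2_hi; move: t3 t4 => a b c d.
case: n IH => [|[|[|n]]] IH; rewrite ?a; try lra.
rewrite exprS; set x := t ^+ _ in IH *.
have x0 : 0 <= x by apply: exprn_ge0; apply: ltW.
have : n.+4%:R * t <= n.+3%:R :> R.
  have n0 : 0 <= n%:R :> R by [].
  rewrite -[n.+4]addn4 -[n.+3]addn3 !natrD; nra.
nra.
Qed.
End CubeRoot.

Ltac natlia := repeat match goal with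
  | H : ?T |- _ =>
    lazymatch T with
    | is_true (leq _ _) => fail
    | is_true (andb (leq _ _) (leq _ _)) => fail
    | @eq nat _ _ => fail
    | _ => clear H
    end
  end; lia.

(** * Numerical inequalities behind the branchings at degree 2 *)

Section Numbers.
Variables (R : realFieldType) (t : R).
Hypotheses (t_gt0 : 0 < t) (t3 : t ^+ 3 = 3^-1).

Let tp m : 0 <= t ^+ m. Proof. exact/exprn_ge0/ltW. Qed.

Lemma nt_anti m n : (3 <= m <= n)%N -> n%:R * t ^+ n <= m%:R * t ^+ m.
Proof.
case/andP=> m3; elim: n => [|n IH]; first by rewrite leqn0 => /eqP ->.
rewrite leq_eqVlt => /orP [/eqP -> //|mn]; apply: le_trans (IH mn).
have := t_hi t3; rewrite exprS mulrA => th; apply: ler_wpM2r => //.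
have n3 : 3 <= n%:R :> R by rewrite ler_nat; lia.
rewrite -addn1 natrD; nra.
Qed.

(** The share of a vertex [p] of degree [d] in [pendant_bound], up to a power of [t]: the edge [x p]
    and the [d - 1] other edges at [p]. The constant is the value at [d] = 3 rounded up; for larger
    [d] the sum is at most [t ^+ 6 + t ^+ 4]. *)
Lemma psi3_le d : (2 < d)%N -> t ^+ (2 + d) + d.-1%:R * t ^+ (d + 3) <= 383 / 1000.
Proof.
have [th th2] := (t_hi t3, t2_hi t_gt0 t3).
case: d => [|[|[|[|d]]]] // _ /=; rewrite ?add2n ?addn3 ?t4 ?t5 ?t6 //; try lra.
have h : t ^+ d.+4.+2 <= t ^+ 6 by apply: (t_mono t_gt0 t3).
have := @nt_anti 3 d.+3 isT; rewrite t3 => h2.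
have -> : t ^+ d.+4.+3 = t ^+ d.+3 * t ^+ 4 by rewrite -exprD addn4.
rewrite mulrA; rewrite t6 // in h.
have : d.+3%:R * t ^+ d.+3 * t ^+ 4 <= 3 / 3 * t ^+ 4 by apply: ler_wpM2r.
rewrite {2}t4 //; lra.
Qed.

(** The worst case is [d] = 2, with value [t ^+ 4 + t ^+ 5]. *)
Lemma psi_le d : (1 < d)%N -> t ^+ (2 + d) + d.-1%:R * t ^+ (d + 3) <= 392 / 1000.
Proof.
rewrite leq_eqVlt => /orP [/eqP <-|/psi3_le h]; last by lra.
by rewrite /= mul1r (t4 t3) (t5 t3); have [] := (t_hi t3, t2_hi t_gt0 t3); lra.
Qed.

(** The same share when the edges at [p] gain one more deleted vertex; the worst case is [d] = 2,
    with value [t ^+ 4 + t ^+ 6]. *)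
Lemma phi_le d : (1 < d)%N -> t ^+ (2 + d) + d.-1%:R * t ^+ (d + 4) <= 343 / 1000.
Proof.
have [th th2] := (t_hi t3, t2_hi t_gt0 t3).
case: d => [|[|[|[|d]]]] // _ /=; rewrite ?add2n ?addn4 ?t4 ?t5 ?t6 ?t7 //; try lra.
have h : t ^+ d.+4.+2 <= t ^+ 6 by apply: (t_mono t_gt0 t3).
have := @nt_anti 3 d.+3 isT; rewrite t3 => h2.
have -> : t ^+ d.+4.+4 = t ^+ d.+3 * t ^+ 5 by rewrite -exprD; congr (_ ^+ _); lia.
rewrite mulrA; rewrite t6 // in h.
have : d.+3%:R * t ^+ d.+3 * t ^+ 5 <= 3 / 3 * t ^+ 5 by apply: ler_wpM2r.
rewrite {2}t5 //; lra.
Qed.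

Let mono m n := @t_mono R t t_gt0 t3 m n.

Let splitE m n k : (k = m + n)%N -> t ^+ k = t ^+ m * t ^+ n.
Proof. by move=> ->; rewrite exprD. Qed.

(** The numbers of [pendant_both]: [b + 1] common neighbours, [x] and [y] of degree [b + 2], and [p]
    of degree [d]. *)
Lemma pendant_numA b d : (1 < d)%N ->
  t ^+ (b.+2 + d) + b.+1%:R * (t ^+ (b.+2 + 2) + t ^+ (b.+2 + 2)) + t ^+ (b + 5) +
  d.-1%:R * t ^+ (d + b + 4) <= 1.
Proof.
move=> d2; have [th th2] := (t_hi t3, t2_hi t_gt0 t3).
have phi := phi_le d2.
rewrite (_ : t ^+ (b.+2 + d) + _ + _ + _ =
   t ^+ b * (t ^+ (2 + d) + d.-1%:R * t ^+ (d + 4)) +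
   2 * t ^+ 3 * (b.+1%:R * t ^+ b.+1) + t ^+ (b + 5)); last first.
  have -> : t ^+ (b.+2 + d) = t ^+ b * t ^+ (2 + d) by apply: splitE; natlia.
  have -> : t ^+ (b.+2 + 2) = t ^+ 3 * t ^+ b.+1 by apply: splitE; natlia.
  have -> : t ^+ (d + b + 4) = t ^+ b * t ^+ (d + 4) by apply: splitE; natlia.
  by move: (t ^+ b) (t ^+ (2 + d)) (t ^+ (d + 4)) (t ^+ 3) (t ^+ b.+1) (t ^+ (b + 5)) => *; ring.
move: phi; set P := _ + _ => phi.
have h := nt_le1 t_gt0 t3 b.+1.
have P0 : 0 <= P by apply: addr_ge0 => //; apply: mulr_ge0.
case: b h => [|[|b]] h.
- by rewrite add0n t5 // t3; lra.
- by rewrite add1n t6 // t3; nra.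
have h7 : t ^+ (b.+2 + 5) <= t ^+ 7 by apply: mono; natlia.
have h2 : t ^+ b.+2 <= t ^+ 2 by apply: mono.
rewrite t7 // in h7; rewrite t3; have := tp b.+2; nra.
Qed.

(** The numbers of [pendant_one], with [k] the degree of [y]. The excluded triple [b] = 0, [k] = 3,
    [d] = 2 gives [2 * (t ^+ 4 + t ^+ 5 + t ^+ 6)], about 1.005. *)
Lemma pendant_numB b d k : (1 < d)%N -> (b.+3 <= k)%N ->
  [|| 0 < b, 3 < k | 2 < d]%N ->
  t ^+ (b.+2 + d) + b.+1%:R * (t ^+ (b.+2 + 2) + t ^+ (k + 2)) +
  (k - b.+1)%:R * t ^+ (k + 3) + d.-1%:R * t ^+ (d + b.+3) <= 1.
Proof.
move=> d2 bk hyp; have [th th2] := (t_hi t3, t2_hi t_gt0 t3).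
have psi := psi_le d2.
rewrite (_ : t ^+ (b.+2 + d) + _ + _ + _ =
   t ^+ b * (t ^+ (2 + d) + d.-1%:R * t ^+ (d + 3)) +
   (t ^+ 3 * (b.+1%:R * t ^+ b.+1) +
    (b.+1%:R * t ^+ (k + 2) + (k - b.+1)%:R * t ^+ (k + 3)))); last first.
  have -> : t ^+ (b.+2 + d) = t ^+ b * t ^+ (2 + d) by apply: splitE; natlia.
  have -> : t ^+ (b.+2 + 2) = t ^+ 3 * t ^+ b.+1 by apply: splitE; natlia.
  have -> : t ^+ (d + b.+3) = t ^+ b * t ^+ (d + 3) by apply: splitE; natlia.
  by move: (t ^+ b) (t ^+ (2 + d)) (t ^+ (d + 3)) (t ^+ 3) (t ^+ b.+1) (t ^+ (k + 2)) (t ^+ (k + 3)) => *; ring.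
have h := nt_le1 t_gt0 t3 b.+1.
have psi3 := @psi3_le d.
move: psi psi3; set P := _ + d.-1%:R * _ => psi psi3.
have P0 : 0 <= P by apply: addr_ge0 => //; apply: mulr_ge0.
have nt m n : (3 <= m <= n)%N -> n%:R * t ^+ n <= m%:R * t ^+ m := @nt_anti m n.
case: b bk hyp h => [|[|b]] bk hyp h.
- case: (leqP k 3) => k3.
    have -> : k = 3%N by apply/eqP; rewrite eqn_leq k3.
    have {}psi3 : P <= 383 / 1000 by apply: psi3; move: hyp; rewrite (leqNgt 4) ltnS k3.
    by rewrite (_ : (3 - 1)%N = 2%N) // t3 t5 // t6 //; lra.
  have h6 : t ^+ (k + 2) <= t ^+ 6 by apply: mono; natlia.
  have hk1 : (3 <= 3 <= k - 1)%N by natlia.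
  have := nt _ _ hk1; rewrite t3 => hk.
  have -> : t ^+ (k + 3) = t ^+ (k - 1) * t ^+ 4 by apply: splitE; natlia.
  rewrite (mulrA (k - 1)%:R).
  move: hk; set K := _ * t ^+ (k - 1) => hk.
  have hK : K * t ^+ 4 <= 3%:R * 3^-1 * t ^+ 4 by apply: ler_wpM2r.
  by rewrite t6 // t4 // in h6 hK *; rewrite expr0 expr1; lra.
- have hP : t * P <= t * (392 / 1000) by apply: ler_wpM2l => //; exact: ltW.
  case: (leqP k 4) => k4.
    have -> : k = 4%N by apply/eqP; rewrite eqn_leq k4.
    by rewrite (_ : (4 - 2)%N = 2%N) // t3 t6 // t7 // expr1; lra.
  have h7 : t ^+ (k + 2) <= t ^+ 7 by apply: mono; natlia.
  have hk2 : (3 <= 3 <= k - 2)%N by natlia.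
  have := nt _ _ hk2; rewrite t3 => hk.
  have -> : t ^+ (k + 3) = t ^+ (k - 2) * t ^+ 5 by apply: splitE; natlia.
  rewrite (mulrA (k - 2)%:R).
  move: hk; set K := _ * t ^+ (k - 2) => hk.
  have hK : K * t ^+ 5 <= 3%:R * 3^-1 * t ^+ 5 by apply: ler_wpM2r.
  by rewrite t7 // t5 // in h7 hK *; rewrite expr1; lra.
have h2 : t ^+ b.+2 <= t ^+ 2 by apply: mono.
have hk : k%:R * t ^+ k <= 4%:R * t ^+ 4 by apply: nt; natlia.
have E : b.+3%:R * t ^+ (k + 2) + (k - b.+3)%:R * t ^+ (k + 3) <= t ^+ 2 * (k%:R * t ^+ k).
  have hh : t ^+ (k + 3) <= t ^+ (k + 2) by apply: mono; natlia.
  have : (k - b.+3)%:R * t ^+ (k + 3) <= (k - b.+3)%:R * t ^+ (k + 2) by apply: ler_wpM2l.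
  have -> : t ^+ 2 * (k%:R * t ^+ k) = (b.+3%:R + (k - b.+3)%:R) * t ^+ (k + 2).
    by rewrite -natrD subnKC ?(ltnW (ltnW bk)) // exprD; ring.
  move=> hc; apply: le_trans (_ : b.+3%:R * t ^+ (k + 2) + (k - b.+3)%:R * t ^+ (k + 2) <= _).
    by rewrite lerD2l.
  by rewrite -mulrDl.
have {E}E := le_trans E (ler_wpM2l (tp 2) hk).
apply: le_trans (_ : t ^+ 2 * P + (t ^+ 3 * 1 + t ^+ 2 * (4 * t ^+ 4)) <= _).
  by apply: lerD; [exact: ler_wpM2r|apply: lerD => //; exact: ler_wpM2l].
have -> : t ^+ 2 * (4 * t ^+ 4) = 4 * t ^+ 6 by rewrite mulrCA -exprD.
by rewrite t6 // t3; nra.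
Qed.

(** For the deletion of all [a] common neighbours of [x] and [y] in [deg2_bound]. The excluded case
    [a] = 1, [k] = [l] = 3 gives [t + 2 * t ^+ 5], about 1.014, and is the alternative left open
    there. *)
Lemma steps_num a k l : (0 < a)%N -> (a.+2 <= k)%N -> (a.+2 <= l)%N ->
  [|| 1 < a, 3 < k | 3 < l]%N ->
  t ^+ a + a%:R * (t ^+ (k + 2) + t ^+ (l + 2)) <= 1.
Proof.
move=> a0 ak al hyp; have [th th2] := (t_hi t3, t2_hi t_gt0 t3).
have hk : t ^+ (k + 2) <= t ^+ (a + 4) by apply: mono; natlia.
have hl : t ^+ (l + 2) <= t ^+ (a + 4) by apply: mono; natlia.
case: (leqP a 1) => a1.
  have E : a = 1%N by natlia. rewrite E in hk hl hyp *.
  have : t ^+ (k + 2) + t ^+ (l + 2) <= t ^+ 5 + t ^+ 6.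
    case/orP: hyp => // /orP [] h.
      have h6 : t ^+ (k + 2) <= t ^+ 6 by apply: mono; natlia.
      by rewrite addrC; apply: lerD.
    have h6 : t ^+ (l + 2) <= t ^+ 6 by apply: mono; natlia.
    by apply: lerD.
  by rewrite t5 // t6 // expr1; lra.
have h : t ^+ a <= t ^+ 2 by apply: mono.
have := nt_le1 t_gt0 t3 a.
have : a%:R * (t ^+ (k + 2) + t ^+ (l + 2)) <= 2 * t ^+ 4 * (a%:R * t ^+ a).
  have -> : 2 * t ^+ 4 * (a%:R * t ^+ a) = a%:R * (t ^+ (a + 4) + t ^+ (a + 4)).
    by rewrite !exprD; ring.
  by apply: ler_wpM2l => //; apply: lerD.
have := tp 4; rewrite {1}t4 // => ? ? ?.
have : 2 * t ^+ 4 * (a%:R * t ^+ a) <= 2 * t ^+ 4 * 1 by apply: ler_wpM2l => //; rewrite t4 //; lra.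
rewrite {2}t4 //; lra.
Qed.
End Numbers.

(** * Branching *)

Section Branching.
Variables (R : realFieldType) (t : R).
Hypotheses (t_gt0 : 0 < t) (t3 : t ^+ 3 = 3^-1).
Variable V : finType.
Implicit Types (e : rel V) (W Y : {set V}) (x y z u v w : V) (Z s : seq V).

Definition bounded_below m := forall e, trifree e -> (#|active e| < m)%N ->
  #|mims e|%:R * t ^+ #|active e| <= 1.

(** Removing [x] and [y] loses no information, since both belong to every member of the family. *)
Lemma card_edge_family e x y Y (A : {set {set V}}) : trifree e -> e x y ->
  {in A, forall W, [/\ W \in mims e, [disjoint W & Y], x \in W & y \in W]} ->
  (#|A| <= #|[set W :\ x :\ y | W : {set V} in A]|)%N /\
  [set W :\ x :\ y | W : {set V} in A] \subset
    mims (del (del e (nbr e x :|: nbr e y)) Y).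
Proof.
move=> ge exy hA; split.
  rewrite card_in_imset // => W1 W2 /hA [_ _ x1 y1] /hA [_ _ x2 y2] E.
  have nxy : y != x by apply/eqP => E'; rewrite E' trifree_irr in exy.
  have back W : x \in W -> y \in W -> W = x |: (y |: (W :\ x :\ y)).
    by move=> xW yW; rewrite setD1K ?setD1K // !inE nxy.
  by rewrite (back W1) // E -back.
apply/subsetP => _ /imsetP [W /hA [mW d xW yW] ->].
apply: mim_del; first exact: mim_edge.
apply: disjointWl d; apply: (subset_trans (subsetDl _ _)); exact: subsetDl.
Qed.

Lemma active_del2 e Y Y' : active (del (del e Y) Y') \subset active e :\: (Y :|: Y').
Proof.
apply/subsetP => a /(subsetP (active_del _ _)) /setDP [].
move=> /(subsetP (active_del _ _)) /setDP [aS aY] aY'; apply/setDP; split=> //.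
by rewrite in_setU negb_or aY aY'.
Qed.

Lemma nbr_active e x : symmetric e -> nbr e x \subset active e.
Proof.
by move=> sym; apply/subsetP => y; rewrite !inE sym => exy; apply/existsP; exists x.
Qed.

(** The family embeds into the maximal induced matchings of a graph with at least [k] fewer active
    vertices, to which induction applies; each lost vertex is worth a factor [t]. The loss is never
    zero because [y] itself is lost. *)
Lemma card_edge_bound e x y Y (A : {set {set V}}) k : trifree e ->
  bounded_below #|active e| -> e x y ->
  {in A, forall W, [/\ W \in mims e, [disjoint W & Y], x \in W & y \in W]} ->
  (k <= #|active e :&: (nbr e x :|: nbr e y :|: Y)|)%N ->
  #|A|%:R * t ^+ #|active e| <= t ^+ k.
Proof.
move=> ge IH exy hA hk; have [h1 h2] := card_edge_family ge exy hA.
set e' := del _ _ in h2.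
have ge' : trifree e' by do 2!apply: trifree_del.
have hAf : (#|A| <= #|mims e'|)%N := leq_trans h1 (subset_leq_card h2).
set Y' := _ :|: Y in hk.
have hc : (#|active e'| + #|active e :&: Y'| <= #|active e|)%N.
  rewrite addnC -(cardsID Y' (active e)) leq_add2l; exact/subset_leq_card/active_del2.
have hpos : (0 < #|active e :&: Y'|)%N.
  rewrite card_gt0; apply/set0Pn; exists y; rewrite !inE exy andbT.
  by apply/existsP; exists x; rewrite (proj1 ge).
have IHe' := IH _ ge' _.
have {}IHe' : #|mims e'|%:R * t ^+ #|active e'| <= 1 by apply: IHe'; lia.
have tp m : 0 <= t ^+ m by apply: exprn_ge0; apply: ltW.
have le1 : t ^+ #|active e| <= t ^+ #|active e'| * t ^+ k.
  by rewrite -exprD; apply: (t_mono t_gt0 t3); lia.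
apply: le_trans (_ : #|mims e'|%:R * (t ^+ #|active e'| * t ^+ k) <= _).
  by apply: ler_pM => //; rewrite ler_nat.
by rewrite mulrA -[leRHS]mul1r; apply: ler_wpM2r.
Qed.

Definition avoiding e Z : {set {set V}} := [set W in mims e | ~~ has (mem W) Z].

Variable e : rel V.
Hypotheses (ge : trifree e) (IH : bounded_below #|active e|).

Local Notation N := #|active e|.
(** With this normalization the goal reads [rho [::] <= 1], and [gam Z x y] is the price of the edge
    [x y] when [Z] has already been deleted. *)
Definition rho Z : R := #|avoiding e Z|%:R * t ^+ N.
Definition gam Z x y : R :=
  #|[set W in avoiding e Z | (x \in W) && (y \in W)]|%:R * t ^+ N.

Let tN_ge0 : 0 <= t ^+ N. Proof. exact/exprn_ge0/ltW. Qed.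

Lemma avoidingP Z W : reflect (W \in mims e /\ {in Z, forall z, z \notin W})
  (W \in avoiding e Z).
Proof.
apply: (iffP setIdP) => -[mW h]; split=> //.
  by move=> z zZ; apply: contraNN h => zW; apply/hasP; exists z.
by apply/hasPn => z /h.
Qed.

Lemma rho_nil : rho [::] = #|mims e|%:R * t ^+ N.
Proof.
by congr (_%:R * _); apply: eq_card => W; apply/avoidingP/idP => [[]|mW].
Qed.

Lemma gam_nil Z x y : gam Z x y <= gam [::] x y.
Proof.
apply: ler_wpM2r => //; rewrite ler_nat; apply/subset_leq_card/subsetP.
by move=> W /setIdP [/avoidingP [mW _] h]; apply/setIdP; split=> //; apply/avoidingP.
Qed.

(** A matching that avoids [Z] either avoids [z] as well or matches it to a neighbour outside [Z],
    which must occur in [L]. *)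
Lemma rho_step Z z (L : seq V) : (forall y, e z y -> (y \in Z) || (y \in L)) ->
  rho Z <= rho (z :: Z) + \sum_(y <- L) gam Z z y.
Proof.
move=> hL; rewrite /rho /gam -mulr_suml -mulrDl; apply: ler_wpM2r => //.
rewrite -natr_sum -natrD ler_nat.
have E (P : pred {set V}) : #|[set W in mims e | P W]| = (\sum_(W in mims e) P W)%N.
  by rewrite -sum1dep_card big_mkcondr; apply: eq_bigr => W _; case: (P W).
have E2 y : #|[set W in avoiding e Z | (z \in W) && (y \in W)]| =
    (\sum_(W in mims e) (~~ has (mem W) Z && ((z \in W) && (y \in W))))%N.
  by rewrite -E; apply: eq_card => W; apply/setIdP/setIdP => [[/setIdP [-> ->] ->]//|[mW /andP [h ->]]]; split=> //; apply/setIdP.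
under eq_bigr => y _ do rewrite E2.
rewrite exchange_big /= /avoiding !E -big_split /=; apply: leq_sum => W mW.
rewrite negb_or; case: (boolP (has (mem W) Z)) => hZ; first by rewrite leq0n.
rewrite andbT; case: (boolP (z \in W)) => zW; last by rewrite leq_addr.
have [y yW ezy] := mim_partner mW zW.
have yL : y \in L.
  by case/orP: (hL y ezy) => // yZ; case/negP: hZ; apply/hasP; exists y.
rewrite -big_mkcond /= (big_rem y) //= yW; lia.
Qed.

Lemma rho_drop Z z : {subset nbr e z <= Z} -> rho Z <= rho (z :: Z).
Proof.
move=> sub; apply: le_trans (@rho_step Z z [::] _) _; last by rewrite big_nil addr0.
by move=> y ezy; rewrite sub // inE.
Qed.

(** A vertex dominating the edge [u v] would have to be covered. This is impossible if it lies in
    [Z], and also if all its possible partners do. *)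
Lemma rho_stop Z u v : e u v ->
  (forall w, e u w || e v w -> (w \in Z) || (nbr e w \subset [set z in Z])) ->
  rho Z <= 0.
Proof.
move=> euv h; suff -> : rho Z = 0 by [].
apply/eqP; rewrite mulf_eq0 pnatr_eq0 cards_eq0; apply/orP; left.
apply/eqP/setP => W; rewrite [RHS]inE; apply/negP => /avoidingP [mW hZ].
have [w wW hw] := mim_dom mW euv.
case/orP: (h w hw) => [/hZ|sub]; first by rewrite wW.
have [y yW ewy] := mim_partner mW wW.
have := subsetP sub y; rewrite !inE ewy => /(_ isT) /hZ.
by rewrite yW.
Qed.

(** The two neighbourhoods are disjoint because [x y] is in no triangle, and [s] lists deleted
    vertices outside both. *)
Lemma card_nbrU Z x y s : e x y -> uniq s ->
  all (fun a => [&& a \in Z, (0 < deg e a)%N, ~~ e x a & ~~ e y a]) s ->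
  (deg e x + deg e y + size s <=
   #|active e :&: (nbr e x :|: nbr e y :|: [set z in Z])|)%N.
Proof.
move=> exy us /allP hs.
have dxy : [disjoint nbr e x & nbr e y].
  apply/pred0P => z /=; rewrite !inE; apply/andP => -[exz eyz].
  by have := proj2 ge _ _ _ exy eyz; rewrite exz.
have <- : #|nbr e x :|: nbr e y| = (deg e x + deg e y)%N.
  by apply/eqP; rewrite (leq_card_setU _ _).2.
have ds : [disjoint nbr e x :|: nbr e y & [set z in s]].
  rewrite disjoint_sym; apply/pred0P => z /=; rewrite !inE; apply/andP => -[/hs /and4P [_ _ a b]].
  by rewrite (negPf a) (negPf b).
have -> : size s = #|[set z in s]| by rewrite cardsE; apply/esym/card_uniqP.
have <- : #|nbr e x :|: nbr e y :|: [set z in s]| =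
    (#|nbr e x :|: nbr e y| + #|[set z in s]|)%N.
  by apply/eqP; rewrite (leq_card_setU _ _).2.
apply/subset_leq_card; rewrite subsetI; apply/andP; split.
  rewrite !subUset !(nbr_active _ (proj1 ge)) /=; apply/subsetP => z; rewrite in_set.
  by move=> /hs /and4P [_ dz _ _]; rewrite -deg_gt0.
by apply: setUS; apply/subsetP => z; rewrite !inE => /hs /and4P [].
Qed.

Lemma avoiding_family Z x y :
  {in [set W in avoiding e Z | (x \in W) && (y \in W)], forall W : {set V},
    [/\ W \in mims e, [disjoint W & [set z in Z]], x \in W & y \in W]}.
Proof.
move=> W /setIdP [/avoidingP [mW h] /andP [xW yW]]; split=> //.
by rewrite disjoint_sym; apply/pred0P => z /=; rewrite !inE; apply/andP => -[/h /negP].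
Qed.

Lemma gam_le Z x y s k : e x y -> uniq s ->
  all (fun a => [&& a \in Z, (0 < deg e a)%N, ~~ e x a & ~~ e y a]) s ->
  (k <= deg e x + deg e y + size s)%N -> gam Z x y <= t ^+ k.
Proof.
move=> exy us hs hk; apply: (card_edge_bound ge IH exy (@avoiding_family Z x y)).
by apply: (leq_trans hk); apply: card_nbrU.
Qed.

Lemma rho_empty Z : (forall W, W \in avoiding e Z -> False) -> rho Z = 0.
Proof.
move=> h; apply/eqP; rewrite mulf_eq0 pnatr_eq0 cards_eq0; apply/orP; left.
by apply/eqP/setP => W; rewrite [RHS]inE; apply/negP => /h.
Qed.

Lemma gam_empty Z x y :
  (forall W, W \in avoiding e Z -> x \in W -> y \in W -> False) -> gam Z x y = 0.
Proof.
move=> h; apply/eqP; rewrite mulf_eq0 pnatr_eq0 cards_eq0; apply/orP; left.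
by apply/eqP/setP => W; rewrite [RHS]inE; apply/negP => /setIdP [aW /andP [xW /(h W aW xW)]].
Qed.

(** If every matching counted is forced to contain a second edge [u v], the edge bound is applied
    again in the reduced graph, where [u v] costs at least its two endpoints. *)
Lemma gam_le2 Z x y s u v k : e x y -> uniq s ->
  all (fun a => [&& a \in Z, (0 < deg e a)%N, ~~ e x a & ~~ e y a]) s ->
  e u v -> uniq [:: u; v; x; y] ->
  (forall W, W \in avoiding e Z -> x \in W -> y \in W -> u \in W /\ v \in W) ->
  (k <= deg e x + deg e y + size s)%N -> gam Z x y <= t ^+ (k + 2).
Proof.
move=> exy us hs euv uu hW hk; have fam := @avoiding_family Z x y.
have := card_nbrU exy us hs; rewrite /gam.
set A := [set W in _ | _] in fam *; set Y := [set z in Z] in fam * => hY.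
have [h1 h2] := card_edge_family ge exy fam.
set A' := imset _ _ in h1 h2; set e' := del (del _ _) _ in h2.
have ge' : trifree e' by do 2!apply: trifree_del.
have hA' W : W \in A' -> u \in W /\ v \in W.
  move=> /imsetP [W0 /setIdP [aW /andP [xW yW]] ->]; have [uW vW] := hW _ aW xW yW.
  by move: uu; rewrite !inE uW vW /= !negb_or => /and4P [/and3P [_ -> ->] /andP [-> ->]].
have hc : (#|active e'| + #|active e :&: (nbr e x :|: nbr e y :|: Y)| <= N)%N.
  rewrite addnC -(cardsID (nbr e x :|: nbr e y :|: Y) (active e)) leq_add2l.
  exact/subset_leq_card/active_del2.
have dx : (0 < deg e x)%N.
  by rewrite deg_gt0 inE; apply/existsP; exists y.
have lt : (#|active e'| < N)%N by lia.
have tp m : 0 <= t ^+ m by apply: exprn_ge0; apply: ltW.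
have bA' : #|A'|%:R * t ^+ #|active e'| <= t ^+ 2.
  case: (set_0Vmem A') => [->|[W WA']]; first by rewrite cards0 mul0r.
  have [uW vW] := hA' W WA'; have mW := subsetP h2 W WA'.
  have [z zW euz] := mim_partner mW uW.
  have [W0 W0A WE] := imsetP WA'; have [mW0 _ _ _] := fam W0 W0A.
  have sub : W \subset W0 by rewrite WE; apply: subset_trans (subsetDl _ _) (subsetDl _ _).
  (* A nonempty family shows that [u v] is still an edge of [e']: the partner of [u] there is also
     its partner in the original matching. *)
  have zv : z = v.
    apply: (mim_inj mW0 (subsetP sub _ uW)) => //; try exact: subsetP sub _ _.
    by move: euz => /and3P [_ _ /and3P []].
  rewrite zv in euz; have evu : e' v u by rewrite (proj1 ge').
  apply: (card_edge_bound ge' _ euz (Y := set0)).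
  - by move=> e'' g'' lt''; apply: IH => //; apply: ltn_trans lt.
  - move=> W' W'A'; have [u' v'] := hA' _ W'A'; split=> //.
      exact: subsetP h2 _ W'A'.
    by rewrite -setI_eq0 setI0.
  have uv : u != v by move: uu; rewrite /= inE negb_or => /andP [/andP []].
  rewrite -[2%N]/(1 + 1)%N -[X in (X <= _)%N](_ : #|[set u; v]| = _); last by rewrite cards2 uv.
  apply/subset_leq_card; rewrite subUset !sub1set !inE euz evu ?orbT /= !andbT.
  by apply/andP; split; apply/existsP; [exists v | exists u].
apply: le_trans (_ : #|A'|%:R * (t ^+ #|active e'| * t ^+ k) <= _).
  apply: ler_pM; rewrite ?ler_nat // -exprD; apply: (t_mono t_gt0 t3); lia.
by rewrite mulrA addnC exprD; apply: ler_wpM2r.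
Qed.

(** Induction in the graph without [Z]; this closes a branching that need not reach an undominated
    edge. *)
Lemma rho_bound Z : uniq Z -> (0 < size Z)%N -> all (fun a => 0 < deg e a)%N Z ->
  rho Z <= t ^+ size Z.
Proof.
move=> uZ sZ /allP hZ; set Y := [set z in Z]; set e' := del e Y.
have cY : #|Y| = size Z by rewrite cardsE; apply/card_uniqP.
have YS : Y \subset active e by apply/subsetP => z; rewrite inE -deg_gt0 => /hZ.
have hc : (#|active e'| + size Z <= N)%N.
  rewrite -cY -(cardsID Y (active e)) (setIidPr YS) addnC leq_add2l.
  exact/subset_leq_card/active_del.
have hf : (#|avoiding e Z| <= #|mims e'|)%N.
  apply/subset_leq_card/subsetP => W /avoidingP [mW h]; apply: mim_del => //.
  by rewrite disjoint_sym; apply/pred0P => z /=; rewrite inE; apply/andP => -[/h /negP].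
have IHe' : #|mims e'|%:R * t ^+ #|active e'| <= 1.
  by apply: IH; [exact: trifree_del|lia].
have tp m : 0 <= t ^+ m by apply: exprn_ge0; apply: ltW.
have le1 : t ^+ N <= t ^+ #|active e'| * t ^+ size Z.
  by rewrite -exprD; apply: (t_mono t_gt0 t3); lia.
apply: le_trans (_ : #|mims e'|%:R * (t ^+ #|active e'| * t ^+ size Z) <= _).
  by apply: ler_pM => //; rewrite ler_nat.
by rewrite mulrA -[leRHS]mul1r; apply: ler_wpM2r.
Qed.

Lemma rho_steps (L : seq V) Z : rho Z <= rho (L ++ Z) +
  \sum_(z <- L) \sum_(y in nbr e z) gam [::] z y.
Proof.
elim: L Z => [|z L IHL] Z; first by rewrite big_nil addr0.
rewrite big_cons addrA; apply: (le_trans (IHL Z)); rewrite lerD2r.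
apply: (le_trans (@rho_step (L ++ Z) z (enum (nbr e z)) _)).
  by move=> y ezy; rewrite mem_enum inE ezy orbT.
rewrite /= lerD2l big_enum /=; apply: ler_sum => y _; exact: gam_nil.
Qed.

Lemma sum_gam_le (L : seq V) (F : V -> R) k : (forall y, y \in L -> F y <= t ^+ k) ->
  \sum_(y <- L) F y <= (size L)%:R * t ^+ k.
Proof.
move=> h; rewrite big_seq; apply: (le_trans (ler_sum _ h)).
by rewrite -big_seq big_const_seq count_predT iter_addr addr0 mulr_natl.
Qed.

End Branching.

Opaque rho gam.

(** * Minimum degree at most 2 *)

Section Core.
Variables (R : realFieldType) (t : R).
Hypotheses (t_gt0 : 0 < t) (t3 : t ^+ 3 = 3^-1).
Variables (V : finType) (e : rel V).
Hypotheses (ge : trifree e) (IH : bounded_below t V #|active e|).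
Hypothesis sep : separated e.

Local Notation rho := (rho t e).
Local Notation gam := (gam t e).
Local Notation dg := (deg e).
Local Notation nb := (nbr e).

Let sym : symmetric e := proj1 ge.
Let tri : forall x y z, e x y -> e y z -> e x z = false := proj2 ge.
Let irr x : e x x = false := trifree_irr x ge.
Let tp m : 0 <= t ^+ m. Proof. exact/exprn_ge0/ltW. Qed.
Let step Z z L := @rho_step R t t_gt0 V e Z z L.
Let stop Z u v := @rho_stop R t V e Z u v.
Let gle Z x y s k := @gam_le R t t_gt0 t3 V e ge IH Z x y s k.
Let mono m n := @t_mono R t t_gt0 t3 m n.
Let tE := (t4 t3, t5 t3, t6 t3, t7 t3, t8 t3, t9 t3, t10 t3).

Let sum_set (S : {set V}) (F : V -> R) k : (forall w, w \in S -> F w <= t ^+ k) ->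
  \sum_(w in S) F w <= #|S|%:R * t ^+ k.
Proof.
move=> h; rewrite -big_enum cardE; apply: sum_gam_le => w; rewrite mem_enum; exact: h.
Qed.

Lemma edge_deg x y : e x y -> (0 < dg x)%N.
Proof. by rewrite deg_gt0 inE => exy; apply/existsP; exists y. Qed.

Lemma edge_neq x y : e x y -> x != y.
Proof. by apply: contraTneq => ->; rewrite irr. Qed.

(** The main use of separation: the inclusion makes [u] and [v] non-adjacent and denies [u] a
    private neighbour. *)
Lemma dominated u v : (0 < dg u)%N -> {subset nb u <= nb v} -> nb u = nb v.
Proof.
rewrite deg_gt0 => us sub; apply/eqP/negPn/negP => /eqP uv.
have euv : e u v = false.
  by case euv: (e u v) => //; rewrite -(irr v); have := sub v; rewrite !inE euv => ->.
move: (us); rewrite inE => /existsP [w euw].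
have evw : e v w by have := sub w; rewrite !inE euw => ->.
have vs : v \in active e by rewrite -deg_gt0; apply: edge_deg evw.
have [u' [v' [h1 _ _ h2 _]]] := sep us vs euv uv.
by have := sub u'; rewrite !inE h1 h2 => /(_ isT).
Qed.

Lemma deg_twin x y : nb x = nb y -> dg x = dg y.
Proof. by rewrite /deg => ->. Qed.

Lemma nbr_extend x (s : seq V) : uniq s -> all (e x) s -> exists s',
  [/\ uniq (s ++ s'), size (s ++ s') = dg x & forall z, e x z = (z \in s ++ s')].
Proof.
move=> us /allP hs; exists [seq z <- enum (nb x) | z \notin s].
have h z : e x z = (z \in s ++ [seq z <- enum (nb x) | z \notin s]).
  rewrite mem_cat mem_filter mem_enum inE; case: (boolP (z \in s)) => //= /hs //.
have u : uniq (s ++ [seq z <- enum (nb x) | z \notin s]).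
  rewrite cat_uniq us filter_uniq ?enum_uniq // andbT.
  by apply/hasPn => z; rewrite mem_filter => /andP [].
split=> //; rewrite -(card_uniqP u); apply: eq_card => z.
by rewrite -h inE.
Qed.

Lemma nbr2_1 x a : e x a -> dg x = 2%N ->
  exists b, uniq [:: a; b] /\ forall z, e x z = (z \in [:: a; b]).
Proof.
move=> exa dx; have hs : all (e x) [:: a] by rewrite /= exa.
have [s [us sz h]] := nbr_extend (isT : uniq [:: a]) hs.
by move: us sz h; rewrite dx; case: s => [|b [|? ?]] // us _ h; exists b.
Qed.

Lemma nbr3_1 x a : e x a -> dg x = 3%N ->
  exists b c, uniq [:: a; b; c] /\ forall z, e x z = (z \in [:: a; b; c]).
Proof.
move=> exa dx; have hs : all (e x) [:: a] by rewrite /= exa.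
have [s [us sz h]] := nbr_extend (isT : uniq [:: a]) hs.
by move: us sz h; rewrite dx; case: s => [|b [|c [|? ?]]] // us _ h; exists b, c.
Qed.

Lemma nbr3_2 x a b : e x a -> e x b -> a != b -> dg x = 3%N ->
  exists c, uniq [:: a; b; c] /\ forall z, e x z = (z \in [:: a; b; c]).
Proof.
move=> exa exb ab dx; have hs : all (e x) [:: a; b] by rewrite /= exa exb.
have us : uniq [:: a; b] by rewrite /= inE ab.
have [s [{}us sz h]] := nbr_extend us hs.
by move: us sz h; rewrite dx; case: s => [|c [|? ?]] // us _ h; exists c.
Qed.

Lemma deg_seq x s : uniq s -> (forall z, e x z = (z \in s)) -> dg x = size s.
Proof. by move=> /card_uniqP <- h; apply: eq_card => z; rewrite -h inE. Qed.

Lemma rho_drops (L : seq V) Z : (forall z, z \in L -> {subset nb z <= Z}) ->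
  rho Z <= rho (L ++ Z).
Proof.
elim: L => //= z L IHL h; apply: le_trans (rho_drop t_gt0 _).
- by apply: IHL => a aL; apply: h; rewrite inE aL orbT.
- by move=> a az; rewrite mem_cat (h z) ?orbT ?mem_head.
Qed.

(** Every neighbour of [w] contains the leaf's neighbourhood in its own and is thus a twin of [v],
    so the component is a star. With d leaves its edges cost d times [t ^+ (d + 1)], at most [t]. *)
Lemma deg1_bound v : dg v = 1%N -> rho [::] <= 1.
Proof.
move=> dv; have [[|w [|? ?]] [_ sz hv]] := @nbr_extend v [::] isT isT; rewrite dv // in sz.
have evw : e v w by rewrite hv mem_head.
have tw y : e w y -> dg y = 1%N.
  move=> ewy; rewrite -dv; apply/esym/deg_twin/dominated; rewrite ?dv // => z.
  by rewrite !inE hv inE => /eqP ->; rewrite sym.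
have s1 := @rho_step _ _ t_gt0 _ e [::] w (enum (nb w)).
have {}s1 : rho [::] <= rho [:: w] + \sum_(y <- enum (nb w)) gam [::] w y.
  by apply: s1 => y; rewrite mem_enum inE.
have s2 : rho [:: w] <= 0.
  apply: (@rho_stop _ _ _ _ _ v w evw) => z /orP [|ewz]; first by rewrite hv => ->.
  apply/orP; right; have /cards1P [w' hw'] : #|nb z| == 1%N by rewrite -/(deg e z) tw.
  have : w \in nb z by rewrite inE sym.
  by rewrite hw' inE => /eqP ->; apply/subsetP => a; rewrite !inE.
have s3 : \sum_(y <- enum (nb w)) gam [::] w y <= (dg w)%:R * t ^+ (dg w + 1).
  rewrite {1}[dg w]cardE; apply: sum_gam_le => y; rewrite mem_enum inE => ewy.
  by apply: (gam_le t_gt0 t3 ge IH ewy (s := [::])) => //; rewrite (tw y) ?addn0.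
have := nt_le1 t_gt0 t3 (dg w); have := t_hi t3; rewrite addn1 exprSr mulrA in s3.
have : 0 <= (dg w)%:R * t ^+ dg w by apply: mulr_ge0.
nra.
Qed.

(** All neighbours of [x] dominate [v], hence are its twins. Deleting [x] and [y] leaves [v x]
    undominated and costs at most [2 * t ^+ 2], below 1. If [x] and [y] coincide, [v] is a leaf. *)
Lemma twins_bound v x y : (forall z, e v z = (z \in [:: x; y])) -> nb x = nb y ->
  rho [::] <= 1.
Proof.
move=> hv txy; have evx : e v x by rewrite hv mem_head.
have tw w : e x w -> nb w = nb v.
  move=> exw; apply/esym/dominated; first exact: edge_deg evx.
  move=> z; rewrite !inE hv !inE => /orP [] /eqP ->; first by rewrite sym.
  by rewrite sym -(nbr_eq w txy).
have dv : (2 <= dg v)%N \/ x = y.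
  case: (eqVneq x y) => [|xy]; [by right | left].
  by rewrite (@deg_seq v [:: x; y]) //= inE xy.
case: dv => [dv|E]; last first.
  apply: (@deg1_bound v); apply: (@deg_seq v [:: x]) => // z.
  by rewrite hv -E !inE orbb.
have s1 z Z : nb z = nb x -> rho Z <= rho (z :: Z) + (dg x)%:R * t ^+ (dg x + 2).
  move=> zx; apply: le_trans (@rho_step _ _ t_gt0 _ e Z z (enum (nb x)) _) _.
    by move=> w; rewrite mem_enum -zx inE orbC => ->.
  rewrite lerD2l {1}[dg x]cardE; apply: sum_gam_le => w.
  rewrite mem_enum => xw.
  apply: (gam_le t_gt0 t3 ge IH (s := [::])) => //; first by move: xw; rewrite -zx inE.
  by rewrite addn0 (deg_twin zx) leq_add2l; rewrite inE in xw; rewrite (deg_twin (tw w xw)).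
have := s1 x [::] erefl; have := s1 y [:: x] (esym txy).
have : rho [:: y; x] <= 0.
  apply: (@rho_stop _ _ _ _ _ v x evx) => z /orP [|exz].
    by rewrite hv !inE orbC => ->.
  apply/orP; right; rewrite (tw _ exz); apply/subsetP => a.
  by rewrite !inE hv !inE orbC.
have := nt_le1 t_gt0 t3 (dg x); have := t2_hi t_gt0 t3; rewrite exprD mulrA.
have : 0 <= (dg x)%:R * t ^+ dg x by apply: mulr_ge0.
have := tp 2; nra.
Qed.

Lemma pendant_bound v x y p :
  (forall z, e v z = (z \in [:: x; y])) -> e x p -> ~~ e y p ->
  dg x = #|nb x :&: nb y|.+1 ->
  rho [::] <= t ^+ (dg x + dg p) +
    #|nb x :&: nb y|%:R * (t ^+ (dg x + 2) + t ^+ (dg y + 2)) +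
    \sum_(q in nb y :\: nb x) t ^+ (dg y + dg q + 1) +
    \sum_(w in nb p :\ x) t ^+ (dg p + dg w + #|nb x :&: nb y| + ~~ e y w).
Proof.
set A := _ :&: _ => hv exp nyp dx.
have evx : e v x by rewrite hv mem_head.
have evy : e v y by rewrite hv !inE eqxx orbT.
have nxy : e x y = false by apply: (@tri x v y) => //; rewrite sym.
have vA : v \in A by rewrite !inE -![e _ v]sym evx evy.
have tw z : z \in A -> nb z = nb v.
  rewrite !inE => /andP [exz eyz]; apply/esym/dominated; first exact: edge_deg evx.
  by move=> w; rewrite !inE hv !inE => /orP [] /eqP ->; rewrite sym.
have pA : p \notin A by rewrite !inE negb_and nyp orbT.
have Nx : nb x = p |: A.
  apply/esym/eqP; rewrite eqEcard cardsU1 pA add1n -dx leqnn andbT.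
  by rewrite subUset sub1set inE exp subsetIl.
have xE z : e x z = (z == p) || (z \in A).
  by have := erefl (z \in nb x); rewrite {2}Nx !inE.
have xy : x != y by apply: contraNneq nyp => <-.
have dA z : z \in A -> dg z = 2%N.
  by move=> zA; rewrite (deg_twin (tw z zA)); apply: (@deg_seq v [:: x; y]); rewrite //= inE xy.
have dyA : (#|A| + #|nb y :\: nb x| = dg y)%N by rewrite /A setIC cardsID.
have AE z : (z \in A) = e x z && e y z by rewrite !inE.
clearbody A.
have b1 : rho [::] <= rho [:: x] + (t ^+ (dg x + dg p) + #|A|%:R * t ^+ (dg x + 2)).
  apply: le_trans (@step [::] x (p :: enum A) _) _.
    by move=> z; rewrite xE !inE mem_enum.
  rewrite lerD2l big_cons; apply: lerD.
    by apply: (gle (s := [::])) => //; rewrite addn0.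
  rewrite cardE; apply: sum_gam_le => z; rewrite mem_enum => zA.
  apply: (gle (s := [::])) => //; first by move: zA; rewrite AE => /andP [].
  by rewrite addn0 (dA z zA).
have b2 : rho [:: x] <= rho [:: y; x] + (#|A|%:R * t ^+ (dg y + 2) +
     \sum_(q in nb y :\: nb x) t ^+ (dg y + dg q + 1)).
  apply: le_trans (@step [:: x] y (enum A ++ enum (nb y :\: nb x)) _) _.
    move=> z eyz; rewrite mem_cat !mem_enum AE !inE eyz !andbT.
    by case: (e x z); rewrite ?orbT.
  rewrite lerD2l big_cat /=; apply: lerD.
    rewrite cardE; apply: sum_gam_le => z; rewrite mem_enum => zA.
    apply: (gle (s := [::])) => //; first by move: zA; rewrite AE => /andP [].
    by rewrite addn0 (dA z zA).
  rewrite big_enum /=; apply: ler_sum => q; rewrite !inE => /andP [nxq eyq].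
  apply: (gle (s := [:: x])) => //=.
  by rewrite inE eqxx (edge_deg exp) sym nxy sym nxq.
have b3 : rho [:: y; x] <= rho (enum A ++ [:: y; x]).
  apply: (rho_drops) => z; rewrite mem_enum => /tw -> w.
  by rewrite inE hv !inE orbC.
set Z := _ ++ _ in b3.
have b4 : rho Z <= rho (p :: Z) +
    \sum_(w in nb p :\ x) t ^+ (dg p + dg w + #|A| + ~~ e y w).
  apply: le_trans (@step Z p (enum (nb p :\ x)) _) _.
    move=> w epw; rewrite mem_enum !inE epw mem_cat !inE andbT.
    by case: (w == x); rewrite ?orbT.
  rewrite lerD2l big_enum /=; apply: ler_sum => w; rewrite !inE => /andP [wx epw].
  have npy : ~~ e p y by rewrite sym.
  have wy : w != y by apply: contraNneq npy => <-.
  (* The list [nseq (~~ e y w) y] contains [y] exactly when [y] is not adjacent to [w]. *)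
  apply: (@gle Z p w (enum A ++ nseq (~~ e y w) y)) => //.
  - rewrite cat_uniq enum_uniq /=; apply/andP; split.
      apply/hasPn => a; rewrite mem_nseq mem_enum => /andP [_ /eqP ->].
      by rewrite AE irr andbF.
    by case: (e y w).
  - apply/allP => a; rewrite mem_cat mem_enum mem_nseq => /orP [aA|/andP [ny /eqP ->]].
      rewrite (dA a aA) mem_cat mem_enum aA /=.
      have aE z : e a z = (z \in [:: x; y]) by rewrite (nbr_eq _ (tw a aA)) hv.
      have px : p != x by rewrite eq_sym (edge_neq).
      have py : p != y by apply: contraTneq exp => ->; rewrite nxy.
      by rewrite ![e _ a]sym !aE !inE !negb_or wx wy px py.
    rewrite mem_cat !inE eqxx orbT /= npy [e w y]sym.
    by move: ny; rewrite lt0b => -> ; rewrite (@edge_deg _ v) // sym.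
  - by rewrite size_cat size_nseq -cardE addnA.
have b5 : rho (p :: Z) <= 0.
  apply: (@stop _ _ _ evx) => w /orP [|]; first by rewrite hv !(inE, mem_cat) => /orP [] ->; rewrite ?orbT.
  by rewrite xE => /orP [] h; rewrite !(inE, mem_cat) ?mem_enum h ?orbT.
rewrite mulrDr; move: b1 b2 b3 b4 b5.
move: (rho _) (rho _) (rho _) (rho _) (rho _) => r1 r2 r3 r4 r5.
move: (t ^+ _) (_ * _) (_ * _) (\sum_(q in _) _) (\sum_(w in _) _) => ? ? ? ? ?.
lra.
Qed.

Lemma card_nbr_minus x w : e x w -> #|nb x :\ w| = (dg x).-1.
Proof. by move=> exw; rewrite /deg (cardsD1 w (nb x)) inE exw. Qed.

(** * Minimum degree 2: neighbours of a vertex of degree 2 *)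

Section MinDegree2.
Hypothesis min_deg2 : forall x y, e x y -> (1 < dg x)%N.

(** Separation of [x] and [y] makes their single private neighbours [p] and [q] non-adjacent. A
    neighbour [w] of [p] other than [x] is then never adjacent to [y]: it is not [q], and in [A] it
    would close a triangle with [x] and [p]. So [y] earns a factor [t] in every term at [p]. *)
Lemma pendant_both v x y :
  (forall z, e v z = (z \in [:: x; y])) ->
  dg x = #|nb x :&: nb y|.+1 -> dg y = #|nb x :&: nb y|.+1 -> rho [::] <= 1.
Proof.
set A := _ :&: _ => hv dx dy.
have evx : e v x by rewrite hv mem_head.
have evy : e v y by rewrite hv !inE eqxx orbT.
have exv : e x v by rewrite sym.
have eyv : e y v by rewrite sym.
have nxy : e x y = false by apply: (@tri x v y).
have xs : x \in active e by rewrite -deg_gt0 (edge_deg exv).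
have ys : y \in active e by rewrite -deg_gt0 (edge_deg eyv).
have dA : nb x <> nb y.
  by move=> E; have : #|A| = dg x; [rewrite /A -E setIid | rewrite dx => /n_Sn].
have [p [q [exp eyq xq yp pq]]] := sep xs ys nxy dA.
have Q1 : nb y :\: nb x = [set q].
  have /cards1P [q' hq'] : #|nb y :\: nb x| == 1%N.
    have := cardsID (nb x) (nb y); rewrite setIC -/A -/(dg y) dy -addn1 => /addnI ->.
    by [].
  have : q \in nb y :\: nb x by rewrite !inE xq.
  by rewrite hq' inE => /eqP ->.
have := pendant_bound hv exp (negbT yp) dx; rewrite -/A Q1 big_set1.
have A0 : (0 < #|A|)%N by rewrite card_gt0; apply/set0Pn; exists v; rewrite !inE exv.
have dp : (1 < dg p)%N by apply: (@min_deg2 p x); rewrite sym.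
have dq : (1 < dg q)%N by apply: (@min_deg2 q y); rewrite sym.
have hS : \sum_(w in nb p :\ x) t ^+ (dg p + dg w + #|A| + ~~ e y w) <=
    (dg p).-1%:R * t ^+ (dg p + #|A| + 3).
  have epx : e p x by rewrite sym.
  rewrite -(card_nbr_minus epx); apply: sum_set => w; rewrite !inE => /andP [wx epw].
  have nyw : e y w = false.
    apply/negP => eyw; have wA : w \in A.
      have := set11 w; case: (boolP (e x w)) => [exw _|nxw _]; first by rewrite !inE exw.
      have : w \in nb y :\: nb x by rewrite !inE nxw.
      by rewrite Q1 inE => /eqP E; rewrite E pq in epw.
    by move: wA; rewrite !inE => /andP [/(tri epx)]; rewrite epw.
  have dw : (1 < dg w)%N by apply: (@min_deg2 w p); rewrite sym.
  by rewrite nyw; apply: mono; move: dw; clear; lia.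
move: hS A0; rewrite dx dy; case: #|A| => // b hS _.
have hq : t ^+ (b.+2 + dg q + 1) <= t ^+ (b + 5).
  by apply: mono; move: dq; clear; lia.
have := pendant_numA t_gt0 t3 b dp; rewrite (_ : dg p + b + 4 = dg p + b.+1 + 3)%N; last by clear; lia.
move: hS hq; move: (t ^+ _) (t ^+ (b.+2 + dg q + 1)) => ? ? ? ? ? ?; lra.
Qed.

(** The numerical bound fails only for one common neighbour, [y] of degree 3 and [p] of degree 2.
    Then [p] has a single further neighbour [w], which saves another factor [t] unless it has degree
    2 and is adjacent to [y]. *)
Lemma pendant_one v x y p :
  (forall z, e v z = (z \in [:: x; y])) -> e x p -> ~~ e y p ->
  dg x = #|nb x :&: nb y|.+1 -> (#|nb x :&: nb y|.+2 <= dg y)%N -> rho [::] <= 1.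
Proof.
set A := _ :&: _ => hv exp nyp dx dy.
have evx : e v x by rewrite hv mem_head.
have exv : e x v by rewrite sym.
have evy : e v y by rewrite hv !inE eqxx orbT.
have eyv : e y v by rewrite sym.
have epx : e p x by rewrite sym.
have A0 : (0 < #|A|)%N by rewrite card_gt0; apply/set0Pn; exists v; rewrite !inE exv.
have dp := min_deg2 epx.
have Q1 : #|nb y :\: nb x| = (dg y - #|A|)%N.
  by rewrite /deg -(cardsID (nb x) (nb y)) [nb y :&: _]setIC addKn.
have bnd := pendant_bound hv exp nyp dx.
have hQ : \sum_(q in nb y :\: nb x) t ^+ (dg y + dg q + 1) <=
    (dg y - #|A|)%:R * t ^+ (dg y + 3).
  rewrite -Q1; apply: sum_set => q; rewrite !inE => /andP [_ eyq].
  have dq : (1 < dg q)%N by apply: (@min_deg2 q y); rewrite sym.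
  by apply: mono; move: dq; clear; lia.
have dw w : e p w -> (1 < dg w)%N by move=> epw; apply: (@min_deg2 w p); rewrite sym.
case: (boolP [|| 1 < #|A|, 3 < dg y | 2 < dg p]%N) => hyp.
  have hS : \sum_(w in nb p :\ x) t ^+ (dg p + dg w + #|A| + ~~ e y w) <=
      (dg p).-1%:R * t ^+ (dg p + #|A|.+2).
    rewrite -(card_nbr_minus epx); apply: sum_set => w; rewrite !inE => /andP [wx epw].
    by apply: mono; move: (dw w epw); clear; lia.
  move: hS hQ bnd A0 dy hyp; rewrite -/A dx; case: #|A| => // b hS hQ bnd _ dy hyp.
  have := pendant_numB t_gt0 t3 dp dy hyp.
  move: bnd hS hQ; move: (t ^+ (b.+2 + dg p)) (_ * _) (\sum_(q in _) _) (\sum_(w in _) _) (_ * _) (_ * _).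
  by move=> ? ? ? ? ? ? ? ? ? ?; lra.
have [a1 [dy3 dp2]] : #|A| = 1%N /\ dg y = 3%N /\ dg p = 2%N.
  by move: hyp A0 dy dp; clear; rewrite !negb_or -!leqNgt => /and3P []; lia.
have [w [uw pE]] := nbr2_1 epx dp2.
have epw : e p w by rewrite pE !inE eqxx orbT.
have xw : x != w by move: uw; rewrite /= inE andbT.
have Pw : nb p :\ x = [set w].
  apply/setP => z; rewrite !inE pE !inE; case: (eqVneq z x) => [->|] //=.
  by rewrite (negPf xw).
have dwge : (1 < dg w)%N := dw w epw.
case: (boolP ((2 < dg w) || ~~ e y w)%N) => [hw|].
  have hw6 : t ^+ (2 + dg w + 1 + ~~ e y w) <= t ^+ 6.
    by apply: mono; move: hw dwge; clear; case: (e y w) => /=; lia.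
  move: bnd hQ; rewrite -/A Pw big_set1 dx a1 dy3 dp2.
  move: hw6 (t_hi t3) (t2_hi t_gt0 t3).
  move: (\sum_(q in _) _) (t ^+ (2 + dg w + 1 + _)) => S T.
  rewrite (_ : (3 - 1)%N = 2%N) // t4 // t5 // t6 //; lra.
rewrite negb_or negbK -leqNgt => /andP [dw2 eyw].
have dw2' : dg w = 2%N by apply/eqP; rewrite eqn_leq dw2.
have vw : e v w = false.
  rewrite hv !inE; apply/norP; split; first by rewrite eq_sym.
  by apply: contraTneq eyw => ->; rewrite irr.
(* In the last configuration [p] takes over the role of [v]: its neighbours [x] and [w] have degree
   2 and share only [p], so [pendant_both] applies. *)
have I1 : #|nb x :&: nb w| = 1%N.
  apply/eqP; rewrite eqn_leq; apply/andP; split; last first.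
    by rewrite card_gt0; apply/set0Pn; exists p; rewrite !inE exp sym.
  have : nb x :&: nb w \subset nb x :\ v.
    apply/subsetP => z; rewrite !inE => /andP [-> ewz]; rewrite andbT.
    by apply: contraTneq ewz => ->; rewrite sym vw.
  by move/subset_leq_card; rewrite (card_nbr_minus exv) dx a1.
by apply: (@pendant_both p x w pE); rewrite I1 ?dx ?a1 ?dw2'.
Qed.

(** If [x] and [y] are not twins, separation gives each a private neighbour. When one of them has
    exactly one, a pendant bound applies; when both have at least two, deleting their common
    neighbours suffices, up to a single exception. *)
Lemma deg2_bound v x y : uniq [:: x; y] -> (forall z, e v z = (z \in [:: x; y])) ->
  rho [::] <= 1 \/ [/\ dg x = 3%N, dg y = 3%N & forall w, e x w -> e y w -> w = v].
Proof.
move=> uxy hv; have xy : x != y by move: uxy; rewrite /= inE andbT.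
have hv' z : e v z = (z \in [:: y; x]) by rewrite hv !inE orbC.
have evx : e v x by rewrite hv mem_head.
have exv : e x v by rewrite sym.
have evy : e v y by rewrite hv !inE eqxx orbT.
have eyv : e y v by rewrite sym.
have nxy : e x y = false by apply: (@tri x v y).
have xs : x \in active e by rewrite -deg_gt0 (edge_deg exv).
have ys : y \in active e by rewrite -deg_gt0 (edge_deg eyv).
case: (eqVneq (nb x) (nb y)) => [txy|/eqP dxy].
  by left; apply: (twins_bound hv txy).
have [p [q [exp eyq xq yp pq]]] := sep xs ys nxy dxy.
pose A := nb x :&: nb y.
have A0 : (0 < #|A|)%N by rewrite card_gt0; apply/set0Pn; exists v; rewrite !inE exv.
have hx : (#|A| < dg x)%N.
  apply: proper_card; apply/properP; split; first exact: subsetIl.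
  by exists p; rewrite !inE ?exp ?yp.
have hy : (#|A| < dg y)%N.
  apply: proper_card; apply/properP; split; first exact: subsetIr.
  by exists q; rewrite !inE ?eyq ?xq.
case: (ltngtP (dg x) #|A|.+1) => [|hx2|dx]; first by rewrite ltnS leqNgt hx.
  case: (ltngtP (dg y) #|A|.+1) => [|hy2|dy]; first by rewrite ltnS leqNgt hy.
    case: (boolP [|| 1 < #|A|, 3 < dg x | 3 < dg y]%N) => hyp; last first.
      right; have [a1 dx dy] : [/\ #|A| = 1%N, dg x = 3%N & dg y = 3%N].
        by move: hyp A0 hx2 hy2; clear; rewrite !negb_or -!leqNgt => /and3P []; split; lia.
      split=> // w exw eyw; have /eqP/cards1P [a Aa] := a1.
      have : w \in A by rewrite !inE exw.
      have : v \in A by rewrite !inE exv.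
      by rewrite Aa !inE => /eqP -> /eqP.
    left; apply: le_trans (steps_num t_gt0 t3 A0 hx2 hy2 hyp).
    have dA z : z \in A -> nb z = nb v.
      rewrite !inE => /andP [exz eyz]; apply/esym/dominated; first exact: edge_deg evx.
      by move=> w; rewrite !inE hv !inE => /orP [] /eqP ->; rewrite sym.
    have Nv : nb v = [set x; y] by apply/setP => z; rewrite !inE hv !inE.
    (* Each vertex of [A] is a twin of [v] and has only the edges to [x] and [y]; what remains after
       deleting [A] is bounded by induction. *)
    have b1 := @rho_steps _ _ t_gt0 _ e (enum A) [::].
    rewrite cats0 in b1; apply: le_trans b1 _; apply: lerD.
      have := @rho_bound _ _ t_gt0 t3 _ _ ge IH (enum A); rewrite -cardE; apply=> //.
        exact: enum_uniq.
      apply/allP => z; rewrite mem_enum => zA.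
      by rewrite (deg_twin (dA z zA)) (edge_deg evx).
    rewrite big_enum /=.
    have -> : #|A|%:R * (t ^+ (dg x + 2) + t ^+ (dg y + 2)) =
       \sum_(z in A) (t ^+ (dg x + 2) + t ^+ (dg y + 2)).
      by rewrite sumr_const mulr_natl.
    apply: ler_sum => z zA; rewrite (dA z zA) Nv big_setU1 ?inE //= big_set1.
    have dz : dg z = 2%N by rewrite (deg_twin (dA z zA)); apply: deg_seq hv.
    have [exz eyz] : e x z /\ e y z by move: zA; rewrite !inE => /andP [].
    by apply: lerD; (apply: (gle (s := [::])) => //; first by rewrite sym); rewrite dz addn0 addnC.
  left; apply: (@pendant_one v y x q) => //; first by rewrite xq.
    by rewrite setIC.
  by rewrite setIC.
case: (ltngtP (dg y) #|A|.+1) => [|hy2|dy]; first by rewrite ltnS leqNgt hy.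
  by left; apply: (@pendant_one v x y p) => //; rewrite yp.
by left; apply: (@pendant_both v x y).
Qed.

(** The alternative that [deg2_bound] leaves open; [min_deg2_bound] discharges it. *)
Hypothesis deg2_nbrs : forall v x y, uniq [:: x; y] ->
  (forall z, e v z = (z \in [:: x; y])) ->
  [/\ dg x = 3%N, dg y = 3%N & forall w, e x w -> e y w -> w = v].

Lemma deg2_nbr_deg u z : dg u = 2%N -> e u z -> dg z = 3%N.
Proof.
by move=> du euz; have [w [uw hw]] := nbr2_1 euz du; have [] := deg2_nbrs uw hw.
Qed.

Lemma deg2_common_nbr u z z' w : dg u = 2%N -> e u z -> e u z' -> z != z' ->
  e w z -> e w z' -> w = u.
Proof.
move=> du euz euz' zz' ewz ewz'; have [z2 [uz hz]] := nbr2_1 euz du.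
have E : z' = z2 by move: euz'; rewrite hz !inE eq_sym (negPf zz') => /eqP.
by have [_ _] := deg2_nbrs uz hz; apply; rewrite -?E sym.
Qed.

(** * A vertex of degree 2 with two cubic neighbours *)

Section Deg2Vertex.
Variables v x y p1 p2 q1 q2 : V.
Hypotheses (xy : x != y) (hv : forall z, e v z = (z \in [:: x; y])).
Hypotheses (ux : uniq [:: v; p1; p2]) (hx : forall z, e x z = (z \in [:: v; p1; p2])).
Hypotheses (uy : uniq [:: v; q1; q2]) (hy : forall z, e y z = (z \in [:: v; q1; q2])).

Let dv : dg v = 2%N.
Proof. by apply: deg_seq hv; rewrite /= inE xy. Qed.
Let dx : dg x = 3%N. Proof. exact: deg_seq hx. Qed.
Let dy : dg y = 3%N. Proof. exact: deg_seq hy. Qed.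
Let evx : e v x. Proof. by rewrite hv mem_head. Qed.
Let evy : e v y. Proof. by rewrite hv !inE eqxx orbT. Qed.
Let exv : e x v. Proof. by rewrite sym. Qed.
Let eyv : e y v. Proof. by rewrite sym. Qed.
Let nxy : e x y = false. Proof. exact: (@tri x v y). Qed.
Let nyx : e y x = false. Proof. by rewrite sym. Qed.
Let ep1x : e p1 x. Proof. by rewrite sym hx !inE eqxx orbT. Qed.
Let ep2x : e p2 x. Proof. by rewrite sym hx !inE eqxx !orbT. Qed.
Let exp1 : e x p1. Proof. by rewrite sym. Qed.
Let exp2 : e x p2. Proof. by rewrite sym. Qed.
Let eyq1 : e y q1. Proof. by rewrite hy !inE eqxx orbT. Qed.
Let eyq2 : e y q2. Proof. by rewrite hy !inE eqxx !orbT. Qed.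
Let p12 : p1 != p2. Proof. by move: ux; rewrite /= !inE => /and3P []. Qed.
Let common w : e x w -> e y w -> w = v.
Proof.
by rewrite ![e _ w]sym => h1 h2; apply: (@deg2_common_nbr v x y).
Qed.

Let pv p : p \in [:: p1; p2] -> p != v.
Proof.
by move: ux; rewrite /= !inE negb_or => /and3P [/andP [a b] _ _] /orP [] /eqP ->; rewrite eq_sym.
Qed.

Let qv q : q \in [:: q1; q2] -> q != v.
Proof.
by move: uy; rewrite /= !inE negb_or => /and3P [/andP [a b] _ _] /orP [] /eqP ->; rewrite eq_sym.
Qed.

Let exp p : p \in [:: p1; p2] -> e x p.
Proof. by rewrite hx !inE => ->; rewrite orbT. Qed.

Let npy p : p \in [:: p1; p2] -> e y p = false.
Proof. by move=> hp; apply: contraNF (pv hp) => h; apply/eqP/common => //; exact: exp. Qed.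

Let nqx q : q \in [:: q1; q2] -> e x q = false.
Proof.
move=> hq; apply: contraNF (qv hq) => h; apply/eqP/common => //.
by rewrite hy inE hq orbT.
Qed.

Let nvp p : p \in [:: p1; p2] -> e v p = false.
Proof. by move=> hp; apply: (@tri v x p) => //; exact: exp. Qed.

Let yw_q w : e y w -> w != v -> w \in [:: q1; q2].
Proof. by rewrite hy inE => /orP [->|]. Qed.

Let pw_v p w : p \in [:: p1; p2] -> e p w -> w != v.
Proof. by move=> hp epw; apply: contraTneq epw => ->; rewrite sym nvp. Qed.

Let nvw p w : p \in [:: p1; p2] -> e p w -> w != x -> e v w = false.
Proof.
move=> hp epw wx; rewrite hv !inE (negPf wx) /=; apply: contraTF epw => /eqP ->.
by rewrite sym npy.
Qed.

(** [v], and also [y] when it is not adjacent to [w], are deleted vertices adjacent to neither [p]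
    nor [w]; each earns a factor [t]. *)
Let gam_p Z p w : p \in [:: p1; p2] -> e p w -> w != x -> v \in Z -> y \in Z ->
  gam Z p w <= t ^+ (dg p + dg w + 1 + ~~ e y w).
Proof.
move=> hp epw wx vZ yZ; apply: (gle (s := v :: nseq (~~ e y w) y)) => //=.
- rewrite mem_nseq negb_and; apply/andP; split; last by case: (e y w).
  by apply/orP; right; apply: contraTneq evy => <-; rewrite irr.
- rewrite vZ dv /= ![e _ v]sym nvp // (nvw hp) //=; case: (boolP (e y w)) => //= nyw.
  by rewrite yZ dy /= ![e _ y]sym npy // nyw.
- by rewrite size_nseq addn1 addSn [in X in (_ <= X)%N]addnS.
Qed.

(** As neighbours of [x], [p1] and [p2] are not adjacent, so [p1] earns a further factor [t] unless
    it is adjacent to [w]. *)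
Let gam_p2 Z w : e p2 w -> w != x -> v \in Z -> y \in Z -> p1 \in Z ->
  gam Z p2 w <= t ^+ (dg p2 + dg w + 1 + ~~ e y w + ~~ e p1 w).
Proof.
have hp : p2 \in [:: p1; p2] by rewrite !inE eqxx orbT.
have hp1 : p1 \in [:: p1; p2] by rewrite mem_head.
move=> epw wx vZ yZ p1Z.
apply: (gle (s := v :: nseq (~~ e y w) y ++ nseq (~~ e p1 w) p1)) => //=.
- rewrite mem_cat !mem_nseq cat_uniq.
  have -> : v == y = false by apply: contraTF evy => /eqP <-; rewrite irr.
  have -> : v == p1 = false by rewrite eq_sym; apply: negbTE; apply: pv.
  rewrite !andbF /=; apply/and3P; split; [by case: (e y w)| |by case: (e p1 w)].
  apply/hasPn => z; rewrite !mem_nseq => /andP [_ /eqP ->].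
  by rewrite negb_and; apply/orP; right; apply: contraTneq eyv => <-; rewrite sym nvp.
- rewrite vZ dv /= ![e _ v]sym nvp // (nvw hp) //= all_cat.
  apply/andP; split.
    case: (boolP (e y w)) => //= nyw.
    by rewrite yZ dy /= ![e _ y]sym npy // nyw.
  case: (boolP (e p1 w)) => //= np1w.
  rewrite p1Z (ltnW (min_deg2 ep1x)) [e w _]sym np1w.
  by rewrite (@tri p2 x p1).
- by rewrite size_cat !size_nseq addn1 !addSn [in X in (_ <= X)%N]addnS !addnA.
Qed.

(** Deletion in the order [x], [y], [v], [p1], [p2], where [v] is free; then [v x] is undominated.
    The terms [t ^+ 5] are the edges [x v] and [y v], and the edges from [y] to the q's profit from
    the deleted [x]. *)
Lemma deg2_base : rho [::] <= 2 * t ^+ 5 + (t ^+ (3 + dg p1) + t ^+ (3 + dg p2)) +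
  (t ^+ (4 + dg q1) + t ^+ (4 + dg q2)) +
  \sum_(w in nb p1 :\ x) gam [:: v; y; x] p1 w +
  \sum_(w in nb p2 :\ x) gam [:: p1; v; y; x] p2 w.
Proof.
have b1 : rho [::] <= rho [:: x] + (t ^+ 5 + (t ^+ (3 + dg p1) + t ^+ (3 + dg p2))).
  apply: le_trans (@step [::] x [:: v; p1; p2] _) _; first by move=> z; rewrite hx => ->.
  rewrite lerD2l !big_cons big_nil addr0; apply: lerD; [|apply: lerD];
  by apply: (gle (s := [::])) => //; rewrite dx ?dv addn0.
have b2 : rho [:: x] <= rho [:: y; x] + (t ^+ 5 + (t ^+ (4 + dg q1) + t ^+ (4 + dg q2))).
  apply: le_trans (@step [:: x] y [:: v; q1; q2] _) _.
    by move=> z; rewrite hy => ->; rewrite orbT.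
  rewrite lerD2l !big_cons big_nil addr0; apply: lerD; [|apply: lerD].
  - by apply: (gle (s := [::])) => //; rewrite dy dv.
  - apply: (gle (s := [:: x])) => //=; last by rewrite dy addn1.
    by rewrite mem_head dx nyx sym nqx ?mem_head.
  - apply: (gle (s := [:: x])) => //=; last by rewrite dy addn1.
    by rewrite mem_head dx nyx sym nqx ?inE ?eqxx ?orbT.
have b3 : rho [:: y; x] <= rho [:: v; y; x].
  by apply: (rho_drop t_gt0) => z; rewrite !inE hv !inE orbC.
have b4 := @step [:: v; y; x] p1 (enum (nb p1 :\ x)).
have b5 := @step [:: p1; v; y; x] p2 (enum (nb p2 :\ x)).
rewrite !big_enum /= in b4 b5.
have {}b4 := b4 _; have {}b5 := b5 _.
have b6 : rho [:: p2; p1; v; y; x] <= 0.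
  apply: (@stop _ _ _ evx) => w; rewrite hv hx !inE.
  by case: (w == x); case: (w == y); case: (w == v); case: (w == p1); case: (w == p2).
have {}b4 : rho [:: v; y; x] <= rho [:: p1; v; y; x] + \sum_(w in nb p1 :\ x) gam [:: v; y; x] p1 w.
  by apply: b4 => w ew; rewrite mem_enum !inE ew; case: (w == x); rewrite ?orbT.
have {}b5 : rho [:: p1; v; y; x] <= rho [:: p2; p1; v; y; x] +
    \sum_(w in nb p2 :\ x) gam [:: p1; v; y; x] p2 w.
  by apply: b5 => w ew; rewrite mem_enum !inE ew; case: (w == x); rewrite ?orbT.
move: b1 b2 b3 b4 b5 b6.
move: (\sum_(w in nb p1 :\ x) _) (\sum_(w in nb p2 :\ x) _) (t ^+ 5).
move: (t ^+ (3 + dg p1)) (t ^+ (3 + dg p2)) (t ^+ (4 + dg q1)) (t ^+ (4 + dg q2)).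
move: (rho _) (rho _) (rho _) (rho _) (rho _) (rho _).
by move=> *; lra.
Qed.

Let pendant_nbr p : p \in [:: p1; p2] -> dg p = 2%N ->
  exists w, [/\ e p w, w != x, nb p :\ x = [set w] & dg w = 3%N].
Proof.
move=> hp dp; have epx : e p x by rewrite sym exp.
have [w [uw hw]] := nbr2_1 epx dp.
have xw : w != x by move: uw; rewrite /= inE eq_sym => /andP [].
have epw : e p w by rewrite hw !inE eqxx orbT.
exists w; split=> //; last exact: deg2_nbr_deg dp epw.
by apply/setP => z; rewrite !inE hw !inE; case: (eqVneq z x) => [->|//]; rewrite eq_sym (negPf xw).
Qed.

Let n1w w : dg p1 = 2%N -> e p2 w -> w != x -> e p1 w = false.
Proof.
move=> dp1 e2w wx; apply: contraNF p12 => e1w; apply/eqP/esym.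
by apply: (@deg2_common_nbr p1 x w) => //; rewrite eq_sym.
Qed.

Let deg_q q : q \in [:: q1; q2] -> (1 < dg q)%N.
Proof. by move=> hq; apply: (@min_deg2 q y); rewrite sym hy inE hq orbT. Qed.

Let beta q : q \in [:: q1; q2] -> t ^+ (4 + dg q) <= t ^+ 6.
Proof. by move=> /deg_q h; apply: mono; rewrite (leq_add2l 4 2). Qed.

Let beta3 q : (2 < dg q)%N -> t ^+ (4 + dg q) <= t ^+ 7.
Proof. by move=> h; apply: mono; rewrite (leq_add2l 4 3). Qed.

Let q1Q : q1 \in [:: q1; q2]. Proof. exact: mem_head. Qed.
Let q2Q : q2 \in [:: q1; q2]. Proof. by rewrite !inE eqxx orbT. Qed.
Let p1P : p1 \in [:: p1; p2]. Proof. exact: mem_head. Qed.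
Let p2P : p2 \in [:: p1; p2]. Proof. by rewrite !inE eqxx orbT. Qed.

(** A trade-off at the further neighbours [w1] and [w2], which are distinct and cubic. If one is
    adjacent to [y], a factor [t] is lost on its edge, but it is then one of the q's, and its degree
    3 improves the edge from [y]. *)
Lemma deg2_case22 : dg p1 = 2%N -> dg p2 = 2%N -> rho [::] <= 1.
Proof.
move=> dp1 dp2; have [w1 [e1 w1x N1 dw1]] := pendant_nbr p1P dp1.
have [w2 [e2 w2x N2 dw2]] := pendant_nbr p2P dp2.
have n12 := n1w dp1 e2 w2x.
have w12 : w1 != w2 by apply: contraTneq e1 => ->; rewrite n12.
have g1 : gam [:: v; y; x] p1 w1 <= t ^+ (6 + ~~ e y w1).
  by have := @gam_p [:: v; y; x] p1 w1 p1P e1 w1x; rewrite dp1 dw1 !inE !eqxx !orbT; apply.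
have g2 : gam [:: p1; v; y; x] p2 w2 <= t ^+ (7 + ~~ e y w2).
  have := @gam_p2 [:: p1; v; y; x] w2 e2 w2x; rewrite dp2 dw2 n12 !inE !eqxx !orbT /=.
  by rewrite -addnA [(~~ _ + _)%N]addnC addnA; apply.
have := deg2_base; rewrite N1 N2 !big_set1 dp1 dp2 => base.
have [b1 b2] := (beta q1Q, beta q2Q).
have [th th2] := (t_hi t3, t2_hi t_gt0 t3).
have cQ w : e y w -> e p1 w \/ e p2 w -> w \in [:: q1; q2].
  by move=> eyw h; apply: yw_q => //; case: h; apply: pw_v.
move: base g1 g2 b1 b2; move: (gam _ _ _) (gam _ _ _) => G1 G2.
move: (@beta3 q1) (@beta3 q2) => b1' b2'.
case: (boolP (e y w1)) => y1; case: (boolP (e y w2)) => y2.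
- have h1 := cQ _ y1 (or_introl e1); have h2 := cQ _ y2 (or_intror e2).
  have [d1 d2] : dg q1 = 3%N /\ dg q2 = 3%N.
    move: h1 h2; rewrite !inE => /orP [] /eqP E1 /orP [] /eqP E2;
    by move: w12 dw1 dw2; rewrite E1 E2 ?eqxx.
  by rewrite d1 d2 /= !tE => *; lra.
- have /orP h : (2 < dg q1)%N || (2 < dg q2)%N.
    by have := cQ _ y1 (or_introl e1); rewrite !inE => /orP [] /eqP <-; rewrite dw1 ?orbT.
  case: h => [/b1'|/b2']; rewrite /= !tE;
  by move: (t ^+ (4 + dg q1)) (t ^+ (4 + dg q2)) => *; lra.
- have /orP h : (2 < dg q1)%N || (2 < dg q2)%N.
    by have := cQ _ y2 (or_intror e2); rewrite !inE => /orP [] /eqP <-; rewrite dw2 ?orbT.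
  case: h => [/b1'|/b2']; rewrite /= !tE;
  by move: (t ^+ (4 + dg q1)) (t ^+ (4 + dg q2)) => *; lra.
- by rewrite /= !tE; move: (t ^+ (4 + dg q1)) (t ^+ (4 + dg q2)) => *; lra.
Qed.

(* Every matching counted here must also use the edge of q2 other than q2 y and
   q2 p1, whence the exponent 10 instead of 8. *)
Let gam_special r : dg p1 = 2%N -> dg p2 = 3%N -> dg q1 = 2%N -> dg q2 = 3%N ->
  e p1 q2 -> e p2 q1 -> e p2 r -> r != x -> r != q1 ->
  gam [:: p1; v; y; x] p2 r <= t ^+ 10.
Proof.
move=> dp1 dp2 dq1 dq2 e1 e2 er rx rq1.
have [w1 [ew1 w1x N1 dw1]] := pendant_nbr p1P dp1.
have q2x : q2 != x by apply: contraTneq eyq2 => ->; rewrite nyx.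
have w1q : w1 = q2.
  by have : q2 \in nb p1 :\ x; [rewrite !inE q2x | rewrite N1 inE => /eqP].
have N1' z : e p1 z -> z != x -> z = q2.
  by move=> h zx; have : z \in nb p1 :\ x; [rewrite !inE zx | rewrite N1 w1q inE => /eqP].
have eq1y : e q1 y by rewrite sym.
have eq1p2 : e q1 p2 by rewrite sym.
have p2y : p2 != y by apply: contraTneq exp2 => ->; rewrite nxy.
have [z [uz q1E]] := nbr2_1 eq1y dq1.
have zp2 : z = p2 by move: eq1p2; rewrite q1E !inE (negPf p2y) => /eqP.
have n22 : e p2 q2 = false.
  by apply: contraNF p12 => h; rewrite (n1w dp1 h q2x) in e1.
have eq2y : e q2 y by rewrite sym.
have eq2p1 : e q2 p1 by rewrite sym.
have p1y : p1 != y by apply: contraTneq exp1 => ->; rewrite nxy.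
have yp1 : y != p1 by rewrite eq_sym.
have [s [us q2E]] := nbr3_2 eq2y eq2p1 yp1 dq2.
have eq2s : e q2 s by rewrite q2E !inE eqxx !orbT.
have rq2 : r != q2 by apply: contraTneq er => ->; rewrite n22.
have nyr : e y r = false.
  by rewrite hy !inE (negPf rq1) (negPf rq2) (negPf (pw_v p2P er)).
(* Only [q1] or [q2] can dominate the edge [v y], and [q1] would be a second partner of [p2]. The
   partner of [q2] is then [s], its other neighbours being deleted. *)
have key W : W \in avoiding e [:: p1; v; y; x] -> p2 \in W -> r \in W -> q2 \in W /\ s \in W.
  move=> /avoidingP [mW av] p2W rW.
  have avo a : a \in [:: p1; v; y; x] -> a \in W -> False by move=> /av /negP.
  have [a aW ha] := mim_dom mW evy; have q2W : q2 \in W.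
    move: ha; rewrite hv hy !inE => /orP [/orP [] /eqP E|/or3P [] /eqP E]; subst a => //.
    - by case: (@avo x) => //; rewrite !inE eqxx !orbT.
    - by case: (@avo y) => //; rewrite !inE eqxx !orbT.
    - by case: (@avo v) => //; rewrite !inE eqxx !orbT.
    - by move/eqP: rq1; case; apply: (mim_inj mW p2W rW aW).
  split=> //; have [b bW] := mim_partner mW q2W.
  rewrite q2E !inE => /or3P [] /eqP E; subst b => //.
  - by case: (@avo y) => //; rewrite !inE eqxx !orbT.
  - by case: (@avo p1) => //; rewrite !inE eqxx.
have p2q2 : q2 != p2 by apply: contraTneq eyq2 => ->; rewrite npy.
case: (eqVneq s r) => [sr|sr].
  rewrite gam_empty // => W aW p2W rW; have [q2W sW] := key W aW p2W rW.
  move/avoidingP: aW => [mW _]; move/eqP: p2q2; apply.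
  by apply: (mim_inj mW rW q2W p2W); rewrite sym // -sr.
rewrite -[10%N]/(8 + 2)%N.
apply: (@gam_le2 _ _ t_gt0 t3 _ _ ge IH _ _ _ [:: v; y; p1] q2 s) => //.
- rewrite /= !inE negb_or; apply/and3P; split=> //.
  by rewrite (edge_neq evy) eq_sym (pv p1P).
- rewrite /= !inE !eqxx !orbT dv dy (ltnW (min_deg2 ep1x)) /=.
  rewrite ![e _ v]sym ![e _ y]sym (nvp p2P) (nvw p2P er rx) (npy p2P) nyr /=.
  rewrite (@tri p2 x p1) //= andbT sym; apply/negP => h.
  by move/eqP: rq2; apply; apply: N1'.
- have sp2 : s != p2 by apply: contraTneq eq2s => ->; rewrite sym n22.
  have q2r : q2 != r by rewrite eq_sym.
  by rewrite /= !inE !negb_or (edge_neq eq2s) p2q2 q2r sp2 sr (edge_neq er).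
- by rewrite dp2 (_ : 8 = 3 + 2 + 3)%N // leq_add2r leq_add2l; apply: (@min_deg2 r p2); rewrite sym.
Qed.

Let dw_p p w : e p w -> (1 < dg w)%N.
Proof. by move=> epw; apply: (@min_deg2 w p); rewrite sym. Qed.

Let two_nbrs p : p \in [:: p1; p2] -> dg p = 3%N ->
  exists a b, [/\ e p a, e p b, a != x, b != x & a != b /\ nb p :\ x = [set a; b]].
Proof.
move=> hp dp; have epx : e p x by rewrite sym exp.
have [a [b [uab pE]]] := nbr3_1 epx dp; exists a, b.
move: uab; rewrite /= !inE negb_or => /andP [/andP [xa xb] /andP [ab _]].
have ax : a != x by rewrite eq_sym.
have bx : b != x by rewrite eq_sym.
split=> //; rewrite ?pE ?inE ?eqxx ?orbT //; split=> //.
apply/setP => z; rewrite !inE pE !inE; case: (eqVneq z x) => [->|//].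
by rewrite (negPf xa) (negPf xb).
Qed.

(** If [p2] has degree at least 4, its neighbours have degree at least 3, since vertices of degree 2
    have cubic neighbours only. If [p2] is cubic, an edge from it to [a] or [b] costs [t ^+ 8]
    unless its end is [q1], of degree 2. At most one of [a], [b] is, and [gam_special] pays for this
    when moreover [w1] is [q2]. *)
Lemma deg2_case2d : dg p1 = 2%N -> (2 < dg p2)%N -> (2 < dg q2)%N -> rho [::] <= 1.
Proof.
move=> dp1 dp2 dq2; have [w1 [e1 w1x N1 dw1]] := pendant_nbr p1P dp1.
have g1 : gam [:: v; y; x] p1 w1 <= t ^+ (6 + ~~ e y w1).
  by have := @gam_p [:: v; y; x] p1 w1 p1P e1 w1x; rewrite dp1 dw1 !inE !eqxx !orbT; apply.
have g1' : gam [:: v; y; x] p1 w1 <= t ^+ 6.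
  by apply: le_trans g1 _; apply: mono; rewrite leq_addr.
have g2 w : e p2 w -> w != x ->
    gam [:: p1; v; y; x] p2 w <= t ^+ (dg p2 + dg w + 2 + ~~ e y w).
  move=> e2 w2x; apply: le_trans (_ : t ^+ (dg p2 + dg w + 1 + ~~ e y w + ~~ e p1 w) <= _).
    by apply: gam_p2 => //; rewrite !inE !eqxx ?orbT.
  by apply: mono; rewrite (n1w dp1 e2 w2x); clear; lia.
have := deg2_base; rewrite N1 !big_set1 dp1 => base.
have [b1 b2] := (beta q1Q, beta3 dq2).
have [th th2] := (t_hi t3, t2_hi t_gt0 t3).
case: (ltngtP (dg p2) 3) => [|d4|d3]; first by rewrite ltnNge dp2.
  have dw w : e p2 w -> (2 < dg w)%N.
    move=> e2; rewrite ltn_neqAle (dw_p e2) andbT; apply/eqP => /esym dw2.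
    by have := deg2_nbr_deg dw2 (_ : e w p2); rewrite sym => /(_ e2) E; rewrite E in d4.
  have S2 : \sum_(w in nb p2 :\ x) gam [:: p1; v; y; x] p2 w <= (dg p2).-1%:R * t ^+ (dg p2 + 5).
    rewrite -(card_nbr_minus ep2x); apply: sum_set => w; rewrite !inE => /andP [wx e2].
    apply: le_trans (g2 w e2 wx) _; apply: mono; move: (dw w e2); clear; lia.
  have h7 : t ^+ (3 + dg p2) <= t ^+ 7 by apply: mono; rewrite (leq_add2l 3 4).
  have E : (dg p2 + 5 = (dg p2).-1 + 6)%N by move: d4; clear; case: (dg p2) => // d _; rewrite addSnnS.
  have h3 : (dg p2).-1%:R * t ^+ (dg p2).-1 <= 3%:R * t ^+ 3.
    by apply: (nt_anti t_gt0 t3); move: d4; clear; lia.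
  have h6 := ler_wpM2r (tp 6) h3; rewrite E exprD mulrA in S2.
  have {h6}S2 := le_trans S2 h6.
  move: base g1' b1 b2 S2 h7; rewrite t3 !tE.
  move: (gam _ _ _) (\sum_(w in _) _) (t ^+ (3 + dg p2)) (t ^+ (4 + dg q1)) (t ^+ (4 + dg q2)).
  by move=> *; lra.
have [a [b [ea eb ax bx [ab N2]]]] := two_nbrs p2P d3.
rewrite N2 big_setU1 ?inE //= big_set1 d3 in base.
have gw7 w : e p2 w -> w != x -> gam [:: p1; v; y; x] p2 w <= t ^+ 7.
  move=> e2 wx; apply: le_trans (g2 w e2 wx) _; rewrite d3; apply: mono.
  by move: (dw_p e2); clear; lia.
have gw8 w : e p2 w -> w != x -> ~~ (e y w && (dg w == 2%N)) ->
    gam [:: p1; v; y; x] p2 w <= t ^+ 8.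
  move=> e2 wx h; apply: le_trans (g2 w e2 wx) _; rewrite d3; apply: mono.
  by move: h (dw_p e2); clear; case: (e y w) => /=; lia.
have [ga7 gb7] := (gw7 a ea ax, gw7 b eb bx).
have [ga8 gb8] := (gw8 a ea ax, gw8 b eb bx).
have bad w : e p2 w -> e y w && (dg w == 2%N) -> w = q1 /\ dg q1 = 2%N.
  move=> e2 /andP [eyw /eqP dw2]; have := yw_q eyw (pw_v p2P e2).
  by rewrite !inE => /orP [] /eqP E; rewrite -E // in dq2 *; rewrite dw2 in dq2.
have yw1 : e y w1 -> w1 = q2 \/ dg q1 = 3%N.
  move=> eyw; have := yw_q eyw (pw_v p1P e1).
  by rewrite !inE => /orP [] /eqP E; [right; rewrite -E | left].
case: (ltnP 2 (dg q1)) => dq1.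
  have nb8 w : e p2 w -> ~~ (e y w && (dg w == 2%N)).
    by move=> e2; apply/negP => /(bad w e2) [_ E]; rewrite E in dq1.
  move: base (ga8 (nb8 a ea)) (gb8 (nb8 b eb)) g1' (beta3 dq1) b2; rewrite /= !tE.
  move: (gam _ p1 _) (gam _ _ a) (gam _ _ b) (t ^+ (4 + dg q1)) (t ^+ (4 + dg q2)).
  by move=> *; lra.
have {}dq1 : dg q1 = 2%N by apply/eqP; rewrite eqn_leq dq1 deg_q.
have {bad}bad w : e p2 w -> e y w && (dg w == 2%N) -> w = q1.
  by move=> h1 h2; have [] := bad w h1 h2.
have g78 : gam [:: p1; v; y; x] p2 a + gam [:: p1; v; y; x] p2 b <= t ^+ 7 + t ^+ 8.
  case: (boolP (e y a && (dg a == 2%N))) => [ba|/ga8 h8]; last by rewrite addrC; apply: lerD.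
  case: (boolP (e y b && (dg b == 2%N))) => [bb|/gb8 h8]; last exact: lerD.
  by rewrite (bad a ea ba) (bad b eb bb) eqxx in ab.
have g1n : w1 != q2 -> gam [:: v; y; x] p1 w1 <= t ^+ 7.
  move=> h; move: g1; case: (boolP (e y w1)) => // /yw1 [E|]; last by rewrite dq1.
  by rewrite E eqxx in h.
case: (eqVneq w1 q2) => [w1q|/g1n {}g1n]; last first.
  move: base g78 g1n b2; rewrite /= dq1 !tE.
  move: (gam _ p1 _) (gam _ _ a) (gam _ _ b) (t ^+ (4 + dg q2)).
  by move=> *; lra.
have {}dq2 : dg q2 = 3%N by rewrite -w1q.
have ga88 : ~~ (e y a && (dg a == 2%N)) -> ~~ (e y b && (dg b == 2%N)) -> rho [::] <= 1.
  move=> /ga8 ha /gb8 hb; move: base ha hb g1'; rewrite /= dq1 dq2 !tE.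
  move: (gam _ p1 _) (gam _ _ a) (gam _ _ b).
  by move=> *; lra.
have spec c d : e p2 c -> e p2 d -> d != x -> d != c -> e y c && (dg c == 2%N) ->
    gam [:: p1; v; y; x] p2 d <= t ^+ 10.
  move=> ec ed dx' dc bc; have cq := bad c ec bc.
  by apply: gam_special => //; rewrite -?w1q -?cq.
have final c d : gam [:: p1; v; y; x] p2 a + gam [:: p1; v; y; x] p2 b =
      gam [:: p1; v; y; x] p2 c + gam [:: p1; v; y; x] p2 d ->
    gam [:: p1; v; y; x] p2 c <= t ^+ 7 -> gam [:: p1; v; y; x] p2 d <= t ^+ 10 ->
    rho [::] <= 1.
  move=> E hc hd; move: base E hc hd g1'; rewrite /= dq1 dq2 !tE.
  move: (gam _ p1 _) (gam _ _ a) (gam _ _ b) (gam _ _ c) (gam _ _ d).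
  by move=> *; lra.
case: (boolP (e y a && (dg a == 2%N))) => [ba|na].
  by apply: (@final a b) => //; apply: (spec a b) => //; rewrite eq_sym.
case: (boolP (e y b && (dg b == 2%N))) => [bb|nb']; last exact: ga88.
by apply: (@final b a); rewrite 1?addrC //; apply: (spec b a).
Qed.

(** The crude estimate suffices unless [p1] and [p2] are both cubic, when it is about 1.005; one
    edge at [p2] must then gain a factor [t]. *)
Lemma deg2_case33 : (2 < dg p1)%N -> (2 < dg p2)%N -> (2 < dg q1)%N -> (2 < dg q2)%N ->
  rho [::] <= 1.
Proof.
move=> dp1 dp2 dq1 dq2; have [b1 b2] := (beta3 dq1, beta3 dq2).
have [th th2] := (t_hi t3, t2_hi t_gt0 t3).
have dwy p w : p \in [:: p1; p2] -> e p w -> e y w -> (2 < dg w)%N.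
  move=> hp epw eyw; have := yw_q eyw (pw_v hp epw).
  by rewrite !inE => /orP [] /eqP ->.
have gS Z p w : p \in [:: p1; p2] -> v \in Z -> y \in Z -> e p w -> w != x ->
    gam Z p w <= t ^+ (dg p + 4).
  move=> hp vZ yZ epw wx; apply: le_trans (gam_p hp epw wx vZ yZ) _; apply: mono.
  case: (boolP (e y w)) => [/(dwy p w hp epw)|_]; first by clear; lia.
  by move: (dw_p epw); clear; lia.
have sS Z p : p \in [:: p1; p2] -> v \in Z -> y \in Z ->
    \sum_(w in nb p :\ x) gam Z p w <= (dg p).-1%:R * t ^+ (dg p + 4).
  move=> hp vZ yZ; have epx : e p x by rewrite sym exp.
  rewrite -(card_nbr_minus epx); apply: sum_set => w; rewrite !inE => /andP [wx epw].
  exact: gS.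
(* The constants here and in [a4] round up [t ^+ 6 + 2 * t ^+ 7], the value at 3, and
   [t ^+ 7 + t ^+ 5], a bound from 4 on. *)
have a3 d : (2 < d)%N -> t ^+ (3 + d) + d.-1%:R * t ^+ (d + 4) <= 266 / 1000.
  move=> d2; case: (ltngtP d 3) => [|d4|->]; first by rewrite ltnNge d2.
    have h7 : t ^+ (3 + d) <= t ^+ 7 by apply: mono; rewrite (leq_add2l 3 4).
    have E : (d + 4 = d.-1 + 5)%N by move: d4; clear; case: d => // d _; rewrite addSnnS.
    have h3 : d.-1%:R * t ^+ d.-1 <= 3%:R * t ^+ 3.
      by apply: (nt_anti t_gt0 t3); move: d4; clear; lia.
    have h6 := ler_wpM2r (tp 5) h3; rewrite E [t ^+ (d.-1 + 5)]exprD mulrA; apply: le_trans (lerD h7 h6) _.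
    by rewrite t3 !tE; lra.
  by rewrite /= !tE; lra.
have a4 d : (3 < d)%N -> t ^+ (3 + d) + d.-1%:R * t ^+ (d + 4) <= 238 / 1000.
  move=> d4.
  have h7 : t ^+ (3 + d) <= t ^+ 7 by apply: mono; rewrite (leq_add2l 3 4).
  have E : (d + 4 = d.-1 + 5)%N by move: d4; clear; case: d => // d _; rewrite addSnnS.
  have h3 : d.-1%:R * t ^+ d.-1 <= 3%:R * t ^+ 3.
    by apply: (nt_anti t_gt0 t3); move: d4; clear; lia.
  have h6 := ler_wpM2r (tp 5) h3; rewrite E [t ^+ (d.-1 + 5)]exprD mulrA; apply: le_trans (lerD h7 h6) _.
  by rewrite t3 !tE; lra.
have := deg2_base.
have [] := (sS [:: v; y; x] p1 p1P, sS [:: p1; v; y; x] p2 p2P).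
rewrite !inE !eqxx !orbT => /(_ isT isT) S1 /(_ isT isT) S2 base.
have := (a3 _ dp1); have := (a3 _ dp2); have := (a4 (dg p1)); have := (a4 (dg p2)).
case: (ltngtP (dg p1) 3) => [|d1|d1]; first by rewrite ltnNge dp1.
  move=> _ /(_ isT) h1 h2 _; move: base S1 S2 b1 b2 h1 h2; rewrite !tE.
  move: (\sum_(w in _) _) (\sum_(w in _) _) (_ * t ^+ (dg p1 + 4)) (_ * t ^+ (dg p2 + 4)).
  move: (t ^+ (3 + dg p1)) (t ^+ (3 + dg p2)) (t ^+ (4 + dg q1)) (t ^+ (4 + dg q2)).
  by move=> *; lra.
case: (ltngtP (dg p2) 3) => [|d2|d2]; first by rewrite ltnNge dp2.
  move=> /(_ isT) h2 _ _ h1; move: base S1 S2 b1 b2 h1 h2; rewrite !tE.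
  move: (\sum_(w in _) _) (\sum_(w in _) _) (_ * t ^+ (dg p1 + 4)) (_ * t ^+ (dg p2 + 4)).
  move: (t ^+ (3 + dg p1)) (t ^+ (3 + dg p2)) (t ^+ (4 + dg q1)) (t ^+ (4 + dg q2)).
  by move=> *; lra.
move=> _ _ _ _; have [a [b [ea eb ax bx [ab N2]]]] := two_nbrs p2P d2.
have gw7 w : e p2 w -> w != x -> gam [:: p1; v; y; x] p2 w <= t ^+ 7.
  move=> e2 wx; have := @gS [:: p1; v; y; x] p2 w p2P.
  by rewrite d2 !inE !eqxx !orbT; apply.
have gw8 w : e p2 w -> w != x -> ~~ (e y w && e p1 w) ->
    gam [:: p1; v; y; x] p2 w <= t ^+ 8.
  move=> e2 wx h; apply: le_trans (_ : t ^+ (dg p2 + dg w + 1 + ~~ e y w + ~~ e p1 w) <= _).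
    by apply: gam_p2 => //; rewrite !inE !eqxx ?orbT.
  rewrite d2; apply: mono; move: h; case: (boolP (e y w)) => /= eyw.
    by move=> ->; move: (dwy p2 w p2P e2 eyw); clear; lia.
  case: (boolP (e p1 w)) => /= [e1 _|_ _]; last by move: (dw_p e2); clear; lia.
  suff : (2 < dg w)%N by clear; lia.
  rewrite ltn_neqAle (dw_p e2) andbT; apply/eqP => /esym dw2.
  have E : x = w by apply: (@deg2_common_nbr w p1 p2) => //; rewrite sym.
  by move: dw2; rewrite -E dx.
have g78 : gam [:: p1; v; y; x] p2 a + gam [:: p1; v; y; x] p2 b <= t ^+ 7 + t ^+ 8.
  case: (boolP (e y a && e p1 a)) => [/andP [ya pa]|h8]; last first.
    by rewrite addrC; apply: lerD; [exact: gw7 | exact: gw8].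
  case: (boolP (e y b && e p1 b)) => [/andP [yb pb]|h8]; last first.
    by apply: lerD; [exact: gw7 | exact: gw8].
  (* If neither edge gained, [a] and [b] would be the two q's, each adjacent to both p's, and [x]
     and [y] could not be separated. *)
  have aQ := yw_q ya (pw_v p2P ea); have bQ := yw_q yb (pw_v p2P eb).
  have Qab q : q \in [:: q1; q2] -> q = a \/ q = b.
    move: aQ bQ ab; rewrite !inE => /orP [] /eqP -> /orP [] /eqP ->;
    rewrite ?eqxx // => _ /orP [] /eqP ->; by [left | right].
  have xs : x \in active e by rewrite -deg_gt0 dx.
  have ys : y \in active e by rewrite -deg_gt0 dy.
  have Nxy : nb x <> nb y.
    by move=> E; have := npy p1P; rewrite -(nbr_eq _ E) exp1.
  have [x' [y' [exx' eyy' xy' yx' xy'']]] := sep xs ys nxy Nxy.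
  have xP : x' \in [:: p1; p2].
    move: exx'; rewrite hx inE => /orP [/eqP E|//].
    by rewrite E eyv in yx'.
  have yQ : y' \in [:: q1; q2].
    by apply: yw_q => //; apply: contraFneq xy' => ->.
  have pq p : p \in [:: p1; p2] -> e p y'.
    rewrite !inE => /orP [] /eqP ->; by case: (Qab _ yQ) => ->.
  by rewrite (pq _ xP) in xy''.
rewrite N2 big_setU1 ?inE //= big_set1 in base.
move: base S1 g78 b1 b2; rewrite d1 d2 /= !tE.
move: (\sum_(w in _) _) (gam _ _ a) (gam _ _ b) (t ^+ (4 + dg q1)) (t ^+ (4 + dg q2)).
by move=> *; lra.
Qed.

End Deg2Vertex.

(** Up to exchanging [x] with [y] and the two vertices within each pair, the three cases cover all
    distributions of degree 2 among the p's and q's. *)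
Lemma no_deg2 v : dg v = 2%N -> rho [::] <= 1.
Proof.
move=> dv; have /set0Pn [x] : nb v != set0 by rewrite -card_gt0 -/(deg e v) dv.
rewrite inE => evx; have [y [uxy hv]] := nbr2_1 evx dv.
have xy : x != y by move: uxy; rewrite /= inE andbT.
have yx : y != x by rewrite eq_sym.
have hv' z : e v z = (z \in [:: y; x]) by rewrite hv !inE orbC.
have evy : e v y by rewrite hv !inE eqxx orbT.
have exv : e x v by rewrite sym.
have eyv : e y v by rewrite sym.
have [p1 [p2 [ux hx]]] := nbr3_1 exv (deg2_nbr_deg dv evx).
have [q1 [q2 [uy hy]]] := nbr3_1 eyv (deg2_nbr_deg dv evy).
have swu a b : uniq [:: v; a; b] -> uniq [:: v; b; a].
  by rewrite /= !inE !negb_or [b == a]eq_sym => /and3P [/andP [-> ->] -> _].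
have swm a b u : (forall z, e u z = (z \in [:: v; a; b])) ->
    forall z, e u z = (z \in [:: v; b; a]).
  by move=> h z; rewrite h !inE [(z == a) || _]orbC.
have [ux' uy'] := (swu _ _ ux, swu _ _ uy).
have [hx' hy'] := (swm _ _ _ hx, swm _ _ _ hy).
have d2 u w : e u w -> dg w = 2%N \/ (2 < dg w)%N.
  move=> euw; have : (1 < dg w)%N by apply: (@min_deg2 w u); rewrite sym.
  by rewrite leq_eqVlt => /orP [/eqP <-|]; [left | right].
have [e1 e2] : e x p1 /\ e x p2 by rewrite !hx !inE !eqxx !orbT.
have [f1 f2] : e y q1 /\ e y q2 by rewrite !hy !inE !eqxx !orbT.
have c22 := deg2_case22; have c2d := deg2_case2d; have c33 := deg2_case33.
case: (d2 _ _ e1) => dp1; case: (d2 _ _ e2) => dp2.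
- exact: (c22 v x y p1 p2 q1 q2).
- case: (d2 _ _ f1) => dq1; case: (d2 _ _ f2) => dq2.
  + exact: (c22 v y x q1 q2 p1 p2).
  + exact: (c2d v x y p1 p2 q1 q2).
  + exact: (c2d v x y p1 p2 q2 q1).
  + exact: (c2d v x y p1 p2 q1 q2).
- case: (d2 _ _ f1) => dq1; case: (d2 _ _ f2) => dq2.
  + exact: (c22 v y x q1 q2 p1 p2).
  + exact: (c2d v x y p2 p1 q1 q2).
  + exact: (c2d v x y p2 p1 q2 q1).
  + exact: (c2d v x y p2 p1 q1 q2).
- case: (d2 _ _ f1) => dq1; case: (d2 _ _ f2) => dq2.
  + exact: (c22 v y x q1 q2 p1 p2).
  + exact: (c2d v y x q1 q2 p1 p2).
  + exact: (c2d v y x q2 q1 p1 p2).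
  + exact: (c33 v x y p1 p2 q1 q2).
Qed.

End MinDegree2.

Lemma min_deg2_bound v : (forall x y, e x y -> (1 < dg x)%N) -> dg v = 2%N ->
  rho [::] <= 1.
Proof.
move=> d2 dv; apply: contraT; rewrite -ltNge => big;
suff : rho [::] <= 1 by rewrite leNgt big.
apply: (no_deg2 d2 _ dv) => u x y uxy hu.
have [h|//] := deg2_bound d2 uxy hu.
by move: big; rewrite ltNge h.
Qed.

(** * Minimum degree 3 *)

Lemma vertex_step v : (0 < dg v)%N ->
  rho [::] <= t + \sum_(w in nb v) gam [::] v w.
Proof.
move=> dv; apply: le_trans (@step [::] v (enum (nb v)) _) _.
  by move=> w; rewrite mem_enum inE.
rewrite big_enum lerD2r /= -[X in _ <= X]expr1.
by apply: (rho_bound t_gt0 t3 ge IH (Z := [:: v])); rewrite //= dv.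
Qed.

(** One step at [v] costs at most [t + 2 * t ^+ 6 + t ^+ 7], about 0.993. *)
Lemma deg3_next_to_deg4 v w : (forall x y, e x y -> (2 < dg x)%N) ->
  e v w -> dg v = 3%N -> (3 < dg w)%N -> rho [::] <= 1.
Proof.
move=> d3 evw dv dw; have [a [b [u vE]]] := nbr3_1 evw dv.
have Nv : nb v = [set w; a; b] by apply/setP => z; rewrite !inE vE !inE orbA.
have := @vertex_step v; rewrite dv => /(_ isT) base.
have g a' : e v a' -> gam [::] v a' <= t ^+ 6.
  move=> eva; apply: (gle (s := [::])) => //; rewrite dv addn0 (leq_add2l 3 3).
  by apply: (@d3 a' v); rewrite sym.
have gw : gam [::] v w <= t ^+ 7.
  by apply: (gle (s := [::])) => //; rewrite dv addn0 (leq_add2l 3 4).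
move: u; rewrite /= !inE negb_or => /and3P [/andP [wa wb] ab _].
move: base; rewrite Nv -setUA big_setU1 ?inE ?negb_or ?wa ?wb //=.
rewrite big_setU1 ?inE ?ab //= big_set1; have ga := g a _; have gb := g b _.
have := ga _; rewrite vE !inE eqxx orbT => /(_ isT) {}ga.
have := gb _; rewrite vE !inE eqxx !orbT => /(_ isT) {}gb.
move: gw ga gb (t_hi t3) (t2_hi t_gt0 t3); rewrite !tE.
by move: (gam _ _ _) (gam _ _ _) (gam _ _ _) => *; lra.
Qed.

(** By [nt_le1], one step costs at most [t + t ^+ 4]. *)
Lemma deg4_nbrs_deg4 v : (3 < dg v)%N -> (forall w, e v w -> (3 < dg w)%N) ->
  rho [::] <= 1.
Proof.
move=> dv dw; have := @vertex_step v; rewrite (leq_trans _ dv) // => /(_ isT) base.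
have S : \sum_(w in nb v) gam [::] v w <= (dg v)%:R * t ^+ (dg v + 4).
  apply: sum_set => w; rewrite inE => evw; apply: (gle (s := [::])) => //.
  by rewrite addn0 leq_add2l dw.
rewrite exprD mulrA in S.
have := le_trans S (ler_wpM2r (tp 4) (nt_le1 t_gt0 t3 (dg v))).
by move: base (t_hi t3) (t2_hi t_gt0 t3); rewrite !tE; move: (\sum_(w in _) _) => *; lra.
Qed.

(** * Cubic graphs *)

Section Cubic.
Hypothesis cubic : forall x y, e x y -> dg x = 3%N.

Let cubicr x y : e x y -> dg y = 3%N.
Proof. by rewrite sym; apply: cubic. Qed.

Let cgam Z a b s : e a b -> uniq s ->
  all (fun c => [&& c \in Z, (0 < dg c)%N, ~~ e a c & ~~ e b c]) s ->
  gam Z a b <= t ^+ (6 + size s).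
Proof. by move=> eab us hs; apply: (gle eab us hs); rewrite (cubic eab) (cubicr eab). Qed.

(** Deletion of [v], all its neighbours and all neighbours of [x] leaves [v x] undominated. The
    edges at [v] and [x] use five of the nine units [t ^+ 6] available, so the four sums must stay
    within [4 * t ^+ 6]. *)
Lemma cubic_base v x y z p q Ly Lz Lp Lq :
  (forall w, e v w = (w \in [:: x; y; z])) -> (forall w, e x w = (w \in [:: v; p; q])) ->
  (forall w, e y w -> w \in v :: Ly) -> (forall w, e z w -> w \in v :: Lz) ->
  (forall w, e p w -> w \in [:: z; y; x; v] ++ Lp) ->
  (forall w, e q w -> w \in [:: p; z; y; x; v] ++ Lq) ->
  rho [::] <= 5 * t ^+ 6 + \sum_(w <- Ly) gam [:: x; v] y w +
    \sum_(w <- Lz) gam [:: y; x; v] z w + \sum_(w <- Lp) gam [:: z; y; x; v] p w +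
    \sum_(w <- Lq) gam [:: p; z; y; x; v] q w.
Proof.
move=> hv hx hy hz hp hq.
have evx : e v x by rewrite hv mem_head.
have exv : e x v by rewrite sym.
have c0 a b Z : e a b -> gam Z a b <= t ^+ 6 by move=> eab; apply: (@cgam _ _ _ [::]).
have b1 : rho [::] <= rho [:: v] + (t ^+ 6 + (t ^+ 6 + t ^+ 6)).
  apply: le_trans (@step [::] v [:: x; y; z] _) _; first by move=> w; rewrite hv => ->.
  rewrite lerD2l !big_cons big_nil addr0.
  by apply: lerD; [|apply: lerD]; apply: c0; rewrite hv !inE eqxx ?orbT.
have b2 : rho [:: v] <= rho [:: x; v] + (t ^+ 6 + t ^+ 6).
  apply: le_trans (@step [:: v] x [:: p; q] _) _.
    by move=> w; rewrite hx !inE.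
  rewrite lerD2l !big_cons big_nil addr0.
  by apply: lerD; apply: c0; rewrite hx !inE eqxx ?orbT.
have b3 : rho [:: x; v] <= rho [:: y; x; v] + \sum_(w <- Ly) gam [:: x; v] y w.
  by apply: step => w /hy; rewrite !inE => /orP [] ->; rewrite ?orbT.
have b4 : rho [:: y; x; v] <= rho [:: z; y; x; v] + \sum_(w <- Lz) gam [:: y; x; v] z w.
  by apply: step => w /hz; rewrite !inE => /orP [] ->; rewrite ?orbT.
have b5 : rho [:: z; y; x; v] <= rho [:: p; z; y; x; v] +
    \sum_(w <- Lp) gam [:: z; y; x; v] p w.
  by apply: step => w /hp; rewrite mem_cat.
have b6 : rho [:: p; z; y; x; v] <= rho [:: q; p; z; y; x; v] +
    \sum_(w <- Lq) gam [:: p; z; y; x; v] q w.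
  by apply: step => w /hq; rewrite mem_cat.
have b7 : rho [:: q; p; z; y; x; v] <= 0.
  apply: (@stop _ _ _ evx) => w; rewrite hv hx !inE.
  by move: (w == x) (w == y) (w == z) (w == v) (w == p) (w == q) => [] [] [] [] [] [].
move: b1 b2 b3 b4 b5 b6 b7.
move: (rho _) (rho _) (rho _) (rho _) (rho _) (rho _) (rho _) (t ^+ 6).
move: (\sum_(w <- Ly) _) (\sum_(w <- Lz) _) (\sum_(w <- Lp) _) (\sum_(w <- Lq) _).
by move=> *; lra.
Qed.

(** [z] and [r] are the only candidates for the private neighbours of [v] and [p]. *)
Let sep3 v p x y z r : uniq [:: x; y; z] -> (forall w, e v w = (w \in [:: x; y; z])) ->
  (forall w, e p w = (w \in [:: x; y; r])) -> r != z -> e z r = false.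
Proof.
move=> u hv hp rz; have [evx epx] : e v x /\ e p x by rewrite hv hp !mem_head.
move: u; rewrite /= !inE !negb_or => /and3P [/andP [xy xz] yz _].
have evz : e v z by rewrite hv !inE eqxx !orbT.
have npz : e p z = false.
  by rewrite hp !inE ![z == _]eq_sym (negPf xz) (negPf yz) (negPf rz).
have nvp : e v p = false by apply: (@tri v x p) => //; rewrite sym.
have vs : v \in active e by rewrite -deg_gt0 (cubic evx).
have ps : p \in active e by rewrite -deg_gt0 (cubic epx).
have Nvp : nb v <> nb p by move=> E; rewrite (nbr_eq _ E) npz in evz.
have [v' [p' [evv' epp' vp' pv' v'p']]] := sep vs ps nvp Nvp.
have v'z : v' = z.
  by move: evv' pv'; rewrite hv hp !inE => /or3P [] /eqP -> //; rewrite eqxx ?orbT.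
have p'r : p' = r.
  by move: epp' vp'; rewrite hv hp !inE => /or3P [] /eqP -> //; rewrite eqxx ?orbT.
by rewrite -v'z -p'r.
Qed.

(** For twins [x] and [y], the cases are the number of vertices among [p], [q] adjacent to [z].
    Every edge leaving the six vertices costs only [t ^+ 8]. *)
Lemma cubic_twins v x y z p q :
  uniq [:: x; y; z] -> (forall w, e v w = (w \in [:: x; y; z])) ->
  uniq [:: v; p; q] -> (forall w, e x w = (w \in [:: v; p; q])) ->
  (forall w, e y w = (w \in [:: v; p; q])) -> (e z q -> e z p) -> rho [::] <= 1.
Proof.
move=> uv hv ux hx hy qp.
have [evx [evy evz]] : e v x /\ e v y /\ e v z by rewrite !hv !inE !eqxx !orbT.
have [exv [exp exq]] : e x v /\ e x p /\ e x q by rewrite !hx !inE !eqxx !orbT.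
have [eyv [eyp eyq]] : e y v /\ e y p /\ e y q by rewrite !hy !inE !eqxx !orbT.
have ezv : e z v by rewrite sym.
have [epx [epy [eqx eqy]]] : e p x /\ e p y /\ e q x /\ e q y by rewrite ![e p _]sym ![e q _]sym.
have [dx [dy [dz [dv [dp dq]]]]] :
    dg x = 3%N /\ dg y = 3%N /\ dg z = 3%N /\ dg v = 3%N /\ dg p = 3%N /\ dg q = 3%N.
  by rewrite (cubic exv) (cubic eyv) (cubic ezv) (cubic evx) (cubic epx) (cubic eqx).
move: (uv); rewrite /= !inE !negb_or => /and3P [/andP [xy xz] yz _].
move: (ux); rewrite /= !inE !negb_or => /and3P [/andP [vp vq] pq _].
have nzx : e z x = false by apply: (@tri z v x).
have nzy : e z y = false by apply: (@tri z v y).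
have nvp : e v p = false by apply: (@tri v x p).
have nvq : e v q = false by apply: (@tri v x q).
have nqp : e q p = false by apply: (@tri q x p).
have Ly w : e y w -> w \in v :: [:: p; q] by rewrite hy.
have c0 a b Z : e a b -> gam Z a b <= t ^+ 6 by move=> eab; apply: (@cgam _ _ _ [::]).
have gz s : e z s -> s != v -> s != p -> s != q -> gam [:: y; x; v] z s <= t ^+ 8.
  move=> ezs sv sp sq; have nsx : e s x = false.
    by rewrite sym hx !inE (negPf sv) (negPf sp) (negPf sq).
  have nsy : e s y = false by rewrite sym hy -hx sym.
  apply: (@cgam [:: y; x; v] z s [:: y; x]) => //=; first by rewrite inE eq_sym xy.
  by rewrite !inE !eqxx !orbT dx dy nzx nzy nsx nsy.
have [th th2] := (t_hi t3, t2_hi t_gt0 t3).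
have gy : \sum_(w <- [:: p; q]) gam [:: x; v] y w <= t ^+ 6 + t ^+ 6.
  by rewrite !big_cons big_nil addr0; apply: lerD; apply: c0.
case: (boolP (e z p)) => [ezp|nzp].
  have epz : e p z by rewrite sym.
  have [p' [up hp]] := nbr3_2 epx epy xy dp.
  have Ep' : p' = z.
    by move: epz; rewrite hp !inE ![z == _]eq_sym (negPf xz) (negPf yz) => /eqP.
  subst p'; have Lp w : e p w -> w \in [:: z; y; x; v] ++ [::].
    by rewrite hp !inE => /or3P [] ->; rewrite ?orbT.
  (* If [z] is adjacent to [q] as well, the component is $K_{3,3}$ and the total is exactly
     [9 * t ^+ 6], without any slack. *)
  case: (boolP (e z q)) => [ezq|nzq].
    have eqz : e q z by rewrite sym.
    have [q' [uq hq]] := nbr3_2 eqx eqy xy dq.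
    have Eq' : q' = z.
      by move: eqz; rewrite hq !inE ![z == _]eq_sym (negPf xz) (negPf yz) => /eqP.
    subst q'; have Lq w : e q w -> w \in [:: p; z; y; x; v] ++ [::].
      by rewrite hq !inE => /or3P [] ->; rewrite ?orbT.
    have [z' [uz hz]] := nbr3_2 ezv ezp vp dz.
    have Ez' : z' = q.
      by move: ezq; rewrite hz !inE ![q == _]eq_sym (negPf vq) (negPf pq) => /eqP.
    subst z'; have Lz w : e z w -> w \in v :: [:: p; q] by rewrite hz.
    have := cubic_base hv hx Ly Lz Lp Lq; move: gy; rewrite !big_cons !big_nil !addr0.
    have := c0 z p [:: y; x; v] ezp; have := c0 z q [:: y; x; v] ezq.
    rewrite !tE; move: (gam _ y p) (gam _ y q) (gam _ z p) (gam _ z q) (rho _).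
    by move=> *; lra.
  have [s [us hz]] := nbr3_2 ezv ezp vp dz.
  have Lz w : e z w -> w \in v :: [:: p; s] by rewrite hz.
  have ezs : e z s by rewrite hz !inE eqxx !orbT.
  have gs : gam [:: y; x; v] z s <= t ^+ 8.
    move: (us); rewrite /= !inE !negb_or => /and3P [/andP [_ vs] ps _].
    by apply: gz => //; rewrite 1?eq_sym //; apply: contraNneq nzq => ->.
  have [r [uq hq]] := nbr3_2 eqx eqy xy dq.
  have eqr : e q r by rewrite hq !inE eqxx !orbT.
  have Lq w : e q w -> w \in [:: p; z; y; x; v] ++ [:: r].
    by rewrite hq !inE => /or3P [] ->; rewrite ?orbT.
  move: (uq); rewrite /= !inE !negb_or => /and3P [/andP [_ xr] yr _].
  have rz : r != z by apply: contraNneq nzq => <-; rewrite sym.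
  have nrv : e r v = false.
    by rewrite sym hv !inE ![r == _]eq_sym (negPf xr) (negPf yr) eq_sym (negPf rz).
  have nrp : e r p = false.
    by rewrite sym hp !inE ![r == _]eq_sym (negPf xr) (negPf yr) eq_sym (negPf rz).
  have gq : gam [:: p; z; y; x; v] q r <= t ^+ 8.
    apply: (@cgam [:: p; z; y; x; v] q r [:: v; p]) => //=; first by rewrite inE vp.
    by rewrite !inE !eqxx !orbT dv dp [e q v]sym nvq nrv nqp nrp.
  have := cubic_base hv hx Ly Lz Lp Lq; move: gy; rewrite !big_cons !big_nil !addr0.
  move: gs gq (c0 z p [:: y; x; v] ezp); rewrite !tE.
  move: (gam _ y p) (gam _ y q) (gam _ z p) (gam _ z s) (gam _ q r) (rho _).
  by move=> *; lra.
have nzq : ~~ e z q by apply: contra nzp.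
have [s [s' [us hz]]] := nbr3_1 ezv dz.
have Lz w : e z w -> w \in v :: [:: s; s'] by rewrite hz.
have [ezs ezs'] : e z s /\ e z s' by rewrite !hz !inE !eqxx !orbT.
move: (us); rewrite /= !inE !negb_or => /and3P [/andP [vs vs'] _ _].
have gs a : e z a -> v != a -> gam [:: y; x; v] z a <= t ^+ 8.
  move=> eza va; apply: gz => //; first by rewrite eq_sym.
    by apply: contraNneq nzp => <-.
  by apply: contraNneq nzq => <-.
have gr Z a : v \in Z -> z \in Z -> e a x -> e a y -> dg a = 3%N -> e z a = false ->
    e v a = false -> exists r, [/\ e a r, forall w, e a w = (w \in [:: x; y; r]) &
                              gam Z a r <= t ^+ 8].
  move=> vZ zZ eax eay da nza nva; have [r [ua ha]] := nbr3_2 eax eay xy da.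
  have ear : e a r by rewrite ha !inE eqxx !orbT.
  exists r; split=> //.
  have rz : r != z by apply: contraFneq nza => <-; rewrite sym.
  have nzr := sep3 uv hv ha rz.
  move: (ua); rewrite /= !inE !negb_or => /and3P [/andP [_ xr] yr _].
  have nvr : e v r = false.
    by rewrite hv !inE ![r == _]eq_sym (negPf xr) (negPf yr) eq_sym (negPf rz).
  apply: (@cgam Z a r [:: v; z]) => //=; first by rewrite inE (edge_neq evz).
  by rewrite vZ zZ dv dz ![e _ v]sym ![e _ z]sym nvr nzr nva nza.
have [r [epr hp gp]] := gr [:: z; y; x; v] p (@mem_last _ z [:: y; x; v]) (mem_head _ _) epx epy dp (negbTE nzp) nvp.
have v5 : v \in [:: p; z; y; x; v] by rewrite !inE eqxx !orbT.
have z5 : z \in [:: p; z; y; x; v] by rewrite !inE eqxx !orbT.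
have [r' [eqr hq gq]] := gr _ q v5 z5 eqx eqy dq (negbTE nzq) nvq.
have Lp w : e p w -> w \in [:: z; y; x; v] ++ [:: r].
  by rewrite hp !inE => /or3P [] ->; rewrite ?orbT.
have Lq w : e q w -> w \in [:: p; z; y; x; v] ++ [:: r'].
  by rewrite hq !inE => /or3P [] ->; rewrite ?orbT.
have := cubic_base hv hx Ly Lz Lp Lq; move: gy; rewrite !big_cons !big_nil !addr0.
move: gp gq (gs s ezs vs) (gs s' ezs' vs'); rewrite !tE.
move: (gam _ y p) (gam _ y q) (gam _ z s) (gam _ z s') (gam _ p r) (gam _ q r') (rho _).
by move=> *; lra.
Qed.

(** Without 4-cycles the deleted vertices are mostly far from later edges; the total is [5 * t ^+ 6
    + 2 * t ^+ 7 + 4 * t ^+ 8 + 2 * t ^+ 9], about 0.997. *)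
Lemma cubic_no_square v : (0 < dg v)%N ->
  (forall a b c d, a != c -> e a b -> e c b -> e a d -> e c d -> b = d) -> rho [::] <= 1.
Proof.
move=> dv0 noC4; have [x evx] : exists x, e v x.
  by move: dv0; rewrite deg_gt0 inE => /existsP.
have dv := cubic evx; have [y [z [uv hv]]] := nbr3_1 evx dv.
have [evy evz] : e v y /\ e v z by rewrite !hv !inE !eqxx !orbT.
have [exv [eyv ezv]] : e x v /\ e y v /\ e z v by rewrite ![e _ v]sym.
have [dx [dy dz]] := (cubic exv, (cubic eyv, cubic ezv)).
have [p [q [ux hx]]] := nbr3_1 exv dx.
have [y1 [y2 [uy hy]]] := nbr3_1 eyv dy.
have [z1 [z2 [uz hz]]] := nbr3_1 ezv dz.
have [exp exq] : e x p /\ e x q by rewrite !hx !inE !eqxx !orbT.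
have [epx eqx] : e p x /\ e q x by rewrite ![e _ x]sym.
have [dp dq] := (cubic epx, cubic eqx).
have [p1 [p2 [up hp]]] := nbr3_1 epx dp.
have [q1 [q2 [uq hq]]] := nbr3_1 eqx dq.
move: (uv); rewrite /= !inE !negb_or => /and3P [/andP [xy xz] yz _].
move: (ux); rewrite /= !inE !negb_or => /and3P [/andP [vp vq] pq _].
move: (uy); rewrite /= !inE !negb_or => /and3P [/andP [vy1 vy2] _ _].
move: (uz); rewrite /= !inE !negb_or => /and3P [/andP [vz1 vz2] _ _].
move: (up); rewrite /= !inE !negb_or => /and3P [/andP [xp1 xp2] _ _].
move: (uq); rewrite /= !inE !negb_or => /and3P [/andP [xq1 xq2] _ _].
have nyx : e y x = false by apply: (@tri y v x).
have nzx : e z x = false by apply: (@tri z v x).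
have nzy : e z y = false by apply: (@tri z v y).
have nvp : e v p = false by apply: (@tri v x p).
have nvq : e v q = false by apply: (@tri v x q).
have nqp : e q p = false by apply: (@tri q x p).
have share a b w : e v a -> e v b -> a != b -> e a w -> v != w -> e b w = false.
  move=> eva evb ab eaw vw; apply: contraNF vw => ebw; apply/eqP.
  by apply: (noC4 a v b w) => //; rewrite sym.
have gy w : e y w -> v != w -> gam [:: x; v] y w <= t ^+ 7.
  move=> eyw vw; have nxw : e x w = false by apply: (share y x) => //; rewrite eq_sym.
  apply: (@cgam [:: x; v] y w [:: x]) => //=.
  by rewrite !inE eqxx dx nyx sym nxw.
have gz w : e z w -> v != w -> gam [:: y; x; v] z w <= t ^+ 8.
  move=> ezw vw; have nxw : e x w = false by apply: (share z x) => //; rewrite eq_sym.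
  have nyw : e y w = false by apply: (share z y) => //; rewrite eq_sym.
  apply: (@cgam [:: y; x; v] z w [:: y; x]) => //=; first by rewrite inE eq_sym xy.
  by rewrite !inE !eqxx !orbT dx dy nzx nzy ![e w _]sym nxw nyw.
(* If both [y] and [z] were adjacent to [w], they would form a 4-cycle with [v] and [w]; hence one
   of them can be counted. *)
have far a w : e x a -> v != a -> e a w -> x != w -> exists b,
    [/\ b \in [:: y; z], e b a = false, e b w = false & e v w = false].
  move=> exa va eaw xw; have nya : e y a = false by apply: (share x y).
  have nza : e z a = false by apply: (share x z).
  have nvw : e v w = false.
    rewrite hv !inE eq_sym (negPf xw) /=; apply/norP; split.
      by apply: contraFneq nya => <-; rewrite sym.
    by apply: contraFneq nza => <-; rewrite sym.
  have vw : v != w by apply: contraTneq eaw => <-; rewrite sym (@tri v x a).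
  case: (boolP (e y w)) => [eyw|nyw].
    by exists z; split; rewrite ?inE ?eqxx ?orbT //; apply: (share y z).
  by exists y; split; rewrite ?inE ?eqxx ?(negbTE nyw).
have dvb b : b \in [:: y; z] -> [/\ dg b = 3%N, v != b & e b v].
  by rewrite !inE => /orP [] /eqP ->; split=> //; apply: (edge_neq).
have gp w : e p w -> x != w -> gam [:: z; y; x; v] p w <= t ^+ 8.
  move=> epw xw; have [b [hb nbp nbw nvw]] := far p w exp vp epw xw.
  have [db vb ebv] := dvb b hb.
  apply: (@cgam [:: z; y; x; v] p w [:: v; b]) => //=; first by rewrite inE vb.
  rewrite ![e _ v]sym ![e _ b]sym nvp nvw nbp nbw dv db.
  by move: hb; rewrite !inE eqxx !orbT => /orP [] ->; rewrite ?orbT.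
have gq w : e q w -> x != w -> gam [:: p; z; y; x; v] q w <= t ^+ 9.
  move=> eqw xw; have [b [hb nbq nbw nvw]] := far q w exq vq eqw xw.
  have [db vb ebv] := dvb b hb.
  have npw : e p w = false.
    by apply: contraNF xw => epw; apply/eqP; apply: (noC4 p x q w).
  have bp : b != p by apply: contraTneq ebv => ->; rewrite sym nvp.
  apply: (@cgam [:: p; z; y; x; v] q w [:: v; b; p]) => //=.
    by rewrite !inE negb_or vb vp bp.
  rewrite ![e _ v]sym ![e _ b]sym ![e _ p]sym nvq nvw nbq nbw sym nqp npw dv db dp.
  by move: hb; rewrite !inE !eqxx !orbT => /orP [] ->; rewrite ?orbT.
have Ly w : e y w -> w \in v :: [:: y1; y2] by rewrite hy.
have Lz w : e z w -> w \in v :: [:: z1; z2] by rewrite hz.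
have Lp w : e p w -> w \in [:: z; y; x; v] ++ [:: p1; p2].
  by rewrite hp !inE => /or3P [] ->; rewrite ?orbT.
have Lq w : e q w -> w \in [:: p; z; y; x; v] ++ [:: q1; q2].
  by rewrite hq !inE => /or3P [] ->; rewrite ?orbT.
have [th th2] := (t_hi t3, t2_hi t_gt0 t3).
have [hy1 hy2] : e y y1 /\ e y y2 by rewrite !hy !inE !eqxx !orbT.
have [hz1 hz2] : e z z1 /\ e z z2 by rewrite !hz !inE !eqxx !orbT.
have [hp1 hp2] : e p p1 /\ e p p2 by rewrite !hp !inE !eqxx !orbT.
have [hq1 hq2] : e q q1 /\ e q q2 by rewrite !hq !inE !eqxx !orbT.
have := cubic_base hv hx Ly Lz Lp Lq; rewrite !big_cons !big_nil !addr0.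
move: (gy _ hy1 vy1) (gy _ hy2 vy2) (gz _ hz1 vz1) (gz _ hz2 vz2).
move: (gp _ hp1 xp1) (gp _ hp2 xp2) (gq _ hq1 xq1) (gq _ hq2 xq2); rewrite !tE.
move: (gam _ y _) (gam _ y _) (gam _ z _) (gam _ z _) (gam _ p _) (gam _ p _) (gam _ q _) (gam _ q _) (rho _).
by move=> *; lra.
Qed.

Section Square.
Hypothesis no_twins : forall a b c, e a c -> nb a = nb b -> a = b.

(** The 4-cycle is [v x p y], and [z], [r], [q], [q'] are the third neighbours of [v], [p], [x],
    [y]. Absence of twins makes [z], [r] distinct and likewise [q], [q']; by [sep3] neither pair is
    adjacent. The last two hypotheses normalize the exchange of [x] and [y]. *)
Lemma cubic_square v p x y z r q q' : v != p ->
  uniq [:: x; y; z] -> (forall w, e v w = (w \in [:: x; y; z])) ->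
  uniq [:: x; y; r] -> (forall w, e p w = (w \in [:: x; y; r])) ->
  uniq [:: v; p; q] -> (forall w, e x w = (w \in [:: v; p; q])) ->
  uniq [:: v; p; q'] -> (forall w, e y w = (w \in [:: v; p; q'])) ->
  (e z q' -> e z q) -> (e z q' -> e q r -> e q' r) -> rho [::] <= 1.
Proof.
move=> nvp' uv hv up hp ux hx uy hy zqq qrr.
have [evx [evy evz]] : e v x /\ e v y /\ e v z by rewrite !hv !inE !eqxx !orbT.
have [exv [eyv ezv]] : e x v /\ e y v /\ e z v by rewrite ![e _ v]sym.
have [epx [epy epr]] : e p x /\ e p y /\ e p r by rewrite !hp !inE !eqxx !orbT.
have [exp exq] : e x p /\ e x q by rewrite !hx !inE !eqxx !orbT.
have [eyp eyq'] : e y p /\ e y q' by rewrite !hy !inE !eqxx !orbT.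
have [eqx eqy'] : e q x /\ e q' y by rewrite ![e _ x]sym ![e _ y]sym.
have erp : e r p by rewrite sym.
have [dx [dy [dz [dv [dp dq]]]]] :
    dg x = 3%N /\ dg y = 3%N /\ dg z = 3%N /\ dg v = 3%N /\ dg p = 3%N /\ dg q = 3%N.
  by rewrite (cubic exv) (cubic eyv) (cubic ezv) (cubic evx) (cubic epx) (cubic eqx).
move: (uv); rewrite /= !inE !negb_or => /and3P [/andP [xy xz] yz _].
move: (ux); rewrite /= !inE !negb_or => /and3P [/andP [vp vq] pq _].
move: (uy); rewrite /= !inE !negb_or => /and3P [/andP [_ vq'] pq' _].
move: (up); rewrite /= !inE !negb_or => /and3P [/andP [_ xr] yr _].
have rz : r != z.
  apply: contraNneq nvp' => E; apply/eqP/(no_twins evx)/setP => w.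
  by rewrite !inE hv hp E.
have qq' : q != q'.
  apply: contraNneq xy => E; apply/eqP/(no_twins exv)/setP => w.
  by rewrite !inE hx hy E.
have nzr : e z r = false := sep3 uv hv hp rz.
have nqq' : e q q' = false by apply: (sep3 ux hx hy); rewrite eq_sym.
have nzx : e z x = false by apply: (@tri z v x).
have nzy : e z y = false by apply: (@tri z v y).
have nyx : e y x = false by apply: (@tri y v x).
have nvp : e v p = false by apply: (@tri v x p).
have nvq : e v q = false by apply: (@tri v x q).
have nqp : e q p = false by apply: (@tri q x p).
have nzp : e z p = false.
  by rewrite sym hp !inE ![z == _]eq_sym (negPf xz) (negPf yz) (negPf rz).
have nyq : e y q = false.
  by rewrite hy !inE ![q == _]eq_sym (negPf vq) (negPf pq) eq_sym (negPf qq').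
have nxq' : e x q' = false.
  by rewrite hx !inE ![q' == _]eq_sym (negPf vq') (negPf pq') (negPf qq').
have nvr : e v r = false.
  by rewrite hv !inE ![r == _]eq_sym (negPf xr) (negPf yr) eq_sym (negPf rz).
have vy : v != y := edge_neq evy.
have vz : v != z := edge_neq evz.
have py : p != y := edge_neq epy.
have pz : p != z by apply: contraTneq evz => <-; rewrite nvp.
have [th th2] := (t_hi t3, t2_hi t_gt0 t3).
have Ly w : e y w -> w \in v :: [:: p; q'] by rewrite hy.
have Lp w : e p w -> w \in [:: z; y; x; v] ++ [:: r].
  by rewrite hp !inE => /or3P [] ->; rewrite ?orbT.
have gyp : gam [:: x; v] y p <= t ^+ 6 by apply: (@cgam _ _ _ [::]).
have gyq : gam [:: x; v] y q' <= t ^+ 7.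
  apply: (@cgam [:: x; v] y q' [:: x]) => //=.
  by rewrite !inE eqxx dx nyx sym nxq'.
have gpr : gam [:: z; y; x; v] p r <= t ^+ 8.
  apply: (@cgam [:: z; y; x; v] p r [:: v; z]) => //=; first by rewrite inE vz.
  by rewrite !inE !eqxx !orbT dv dz ![e _ v]sym ![e _ z]sym nvp nvr nzp nzr.
have xE w : e z w -> w != v -> e x w -> w = q.
  move=> ezw wv; rewrite hx !inE (negPf wv) /= => /orP [/eqP E|/eqP //].
  by rewrite E nzp in ezw.
have yE w : e z w -> w != v -> e y w -> w = q'.
  move=> ezw wv; rewrite hy !inE (negPf wv) /= => /orP [/eqP E|/eqP //].
  by rewrite E nzp in ezw.
have gz8 w : e z w -> w != v -> w != q -> w != q' -> gam [:: y; x; v] z w <= t ^+ 8.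
  move=> ezw wv wq wq'.
  have nxw : e x w = false by apply: contraNF wq => h; apply/eqP/xE.
  have nyw : e y w = false by apply: contraNF wq' => h; apply/eqP/yE.
  apply: (@cgam [:: y; x; v] z w [:: y; x]) => //=; first by rewrite inE eq_sym xy.
  by rewrite !inE !eqxx !orbT dx dy nzx nzy ![e w _]sym nxw nyw.
have gq Z w s : v \in Z -> y \in Z -> e q w -> w != x -> uniq s -> v \notin s ->
    y \notin s -> all (fun c => [&& c \in Z, (0 < dg c)%N, ~~ e q c & ~~ e w c]) s ->
    w != z \/ e q z = false -> gam Z q w <= t ^+ (8 + size s).
  move=> vZ yZ eqw wx us vs ys hs wz.
  have nyw : e y w = false.
    rewrite hy !inE; apply/or3P => -[] /eqP E; subst w.
    - by rewrite sym nvq in eqw.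
    - by rewrite nqp in eqw.
    - by rewrite nqq' in eqw.
  have nvw : e v w = false.
    rewrite hv !inE (negPf wx) /=; apply/orP => -[] /eqP E; subst w.
      by rewrite sym nyq in eqw.
    by case: wz => [/eqP|]; [|rewrite eqw].
  apply: (@cgam Z q w [:: v, y & s]) => //=; first by rewrite inE negb_or vy vs ys us.
  by rewrite vZ yZ dv dy ![e _ v]sym ![e _ y]sym nvq nyq nvw nyw hs.
have [v5 y5] : v \in [:: p; z; y; x; v] /\ y \in [:: p; z; y; x; v].
  by rewrite !inE !eqxx !orbT.
have base := cubic_base hv hx Ly _ Lp _.
case: (boolP (e z q)) => [ezq|nzq]; last first.
  have nzq' : ~~ e z q' by apply: contra nzq.
  have [s1 [s2 [us hz]]] := nbr3_1 ezv dz.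
  have [hz1 hz2] : e z s1 /\ e z s2 by rewrite !hz !inE !eqxx !orbT.
  have g s : e z s -> v != s -> gam [:: y; x; v] z s <= t ^+ 8.
    move=> ezs vs; apply: gz8 => //; first by rewrite eq_sym.
      by apply: contraNneq nzq => <-.
    by apply: contraNneq nzq' => <-.
  have [q1 [q2 [uq hq]]] := nbr3_1 eqx dq.
  have [hq1 hq2] : e q q1 /\ e q q2 by rewrite !hq !inE !eqxx !orbT.
  have nqz : e q z = false by rewrite sym (negbTE nzq).
  have g9 w : e q w -> x != w -> gam [:: p; z; y; x; v] q w <= t ^+ 9.
    move=> eqw xw; have wx : w != x by rewrite eq_sym.
    (* The third deleted vertex is [p] if it is not adjacent to [w]; otherwise [w] is [r], and [z]
       serves instead. *)
    case: (boolP (e w p)) => [ewp|nwp]; last first.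
      apply: (gq _ w [:: p]) => //; rewrite ?inE //; last by right.
        by rewrite eq_sym.
      by rewrite /= !inE eqxx dp nqp nwp.
    apply: (gq _ w [:: z]) => //; rewrite ?inE //; last by right.
    have wr : w = r.
      move: ewp; rewrite sym hp !inE (negPf wx) /= => /orP [] /eqP // E.
      by rewrite E sym nyq in eqw.
    by rewrite /= !inE eqxx orbT dz nqz sym wr nzr.
  have Lz w : e z w -> w \in v :: [:: s1; s2] by rewrite hz.
  have Lq w : e q w -> w \in [:: p; z; y; x; v] ++ [:: q1; q2].
    by rewrite hq !inE => /or3P [] ->; rewrite ?orbT.
  move: (us); rewrite /= !inE !negb_or => /and3P [/andP [vs1 vs2] _ _].
  move: (uq); rewrite /= !inE !negb_or => /and3P [/andP [xq1 xq2] _ _].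
  have := base _ _ Lz Lq; rewrite !big_cons !big_nil !addr0.
  move: gyp gyq gpr (g _ hz1 vs1) (g _ hz2 vs2) (g9 _ hq1 xq1) (g9 _ hq2 xq2); rewrite !tE.
  move: (gam _ y _) (gam _ y _) (gam _ z _) (gam _ z _) (gam _ p _) (gam _ q _) (gam _ q _) (rho _).
  by move=> *; lra.
have eqz : e q z by rewrite sym.
have [q1 [uq hq]] := nbr3_2 eqx eqz xz dq.
have hq1 : e q q1 by rewrite hq !inE eqxx !orbT.
have Lq w : e q w -> w \in [:: p; z; y; x; v] ++ [:: q1].
  by rewrite hq !inE => /or3P [] ->; rewrite ?orbT.
move: (uq); rewrite /= !inE !negb_or => /and3P [/andP [_ xq1] zq1 _].
have q1x : q1 != x by rewrite eq_sym.
have q1z : q1 != z by rewrite eq_sym.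
have gq8 : gam [:: p; z; y; x; v] q q1 <= t ^+ 8.
  by apply: (gq _ q1 [::]) => //; left.
have gzq : gam [:: y; x; v] z q <= t ^+ 7.
  apply: (@cgam [:: y; x; v] z q [:: y]) => //=.
  by rewrite !inE eqxx dy nzy sym nyq.
have [s [us hz]] := nbr3_2 ezv ezq vq dz.
have ezs : e z s by rewrite hz !inE eqxx !orbT.
have Lz w : e z w -> w \in v :: [:: q; s] by rewrite hz.
move: (us); rewrite /= !inE !negb_or => /and3P [/andP [_ vs] qs _].
case: (boolP (e z q')) => [ezq'|nzq']; last first.
  have gs : gam [:: y; x; v] z s <= t ^+ 8.
    by apply: gz8; rewrite // 1?eq_sym //; apply: contraNneq nzq' => ->.
  have := base _ _ Lz Lq; rewrite !big_cons !big_nil !addr0.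
  move: gyp gyq gpr gzq gs gq8; rewrite !tE.
  move: (gam _ y _) (gam _ y _) (gam _ z _) (gam _ z _) (gam _ p _) (gam _ q _) (rho _).
  by move=> *; lra.
have sq' : s = q'.
  by move: ezq'; rewrite hz !inE ![q' == _]eq_sym (negPf vq') (negPf qq') => /eqP.
subst s; have gs : gam [:: y; x; v] z q' <= t ^+ 7.
  apply: (@cgam [:: y; x; v] z q' [:: x]) => //=.
  by rewrite !inE eqxx !orbT dx nzx sym nxq'.
case: (boolP (e q r)) => [eqr|nqr]; last first.
  have g9 : gam [:: p; z; y; x; v] q q1 <= t ^+ 9.
    apply: (gq _ q1 [:: p]) => //; rewrite ?inE //; last by left.
      by rewrite eq_sym.
    rewrite /= !inE eqxx dp nqp /= andbT sym hp !inE (negPf q1x) /=.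
    apply/norP; split; first by apply: contraTneq hq1 => ->; rewrite sym nyq.
    by apply: contraNneq nqr => <-.
  have := base _ _ Lz Lq; rewrite !big_cons !big_nil !addr0.
  move: gyp gyq gpr gzq gs g9; rewrite !tE.
  move: (gam _ y _) (gam _ y _) (gam _ z _) (gam _ z _) (gam _ p _) (gam _ q _) (rho _).
  by move=> *; lra.
(* With all these adjacencies the generic sum [6 * t ^+ 6 + 3 * t ^+ 7 + 2 * t ^+ 8] exceeds 1, so
   the branching is redone and stopped two vertices earlier. *)
have eq'r := qrr ezq' eqr.
have b1 : rho [::] <= rho [:: v] + (t ^+ 6 + (t ^+ 6 + t ^+ 6)).
  apply: le_trans (@step [::] v [:: x; y; z] _) _; first by move=> w; rewrite hv => ->.
  rewrite lerD2l !big_cons big_nil addr0.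
  by apply: lerD; [|apply: lerD]; apply: (@cgam _ _ _ [::]).
have b2 : rho [:: v] <= rho [:: x; v] + (t ^+ 6 + t ^+ 6).
  apply: le_trans (@step [:: v] x [:: p; q] _) _.
    by move=> w; rewrite hx !inE.
  rewrite lerD2l !big_cons big_nil addr0.
  by apply: lerD; apply: (@cgam _ _ _ [::]).
have b3 : rho [:: x; v] <= rho [:: y; x; v] + (gam [:: x; v] y p + gam [:: x; v] y q').
  apply: le_trans (@step [:: x; v] y [:: p; q'] _) _.
    by move=> w; rewrite hy !inE => /or3P [] ->; rewrite ?orbT.
  by rewrite lerD2l !big_cons big_nil addr0.
have b4 : rho [:: y; x; v] <= rho [:: z; y; x; v] +
    (gam [:: y; x; v] z q + gam [:: y; x; v] z q').
  apply: le_trans (@step [:: y; x; v] z [:: q; q'] _) _.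
    by move=> w; rewrite hz !inE => /or3P [] ->; rewrite ?orbT.
  by rewrite lerD2l !big_cons big_nil addr0.
(* v lies in a cube with antipode r: to meet vx, vy and vz, a matching avoiding
   v, x, y, z would have to match two of p, q, q' to r. *)
have b5 : rho [:: z; y; x; v] = 0.
  apply: rho_empty => W /avoidingP [mW av].
  have [nv [nx [ny nz]]] : v \notin W /\ x \notin W /\ y \notin W /\ z \notin W.
    by do !split; apply: av; rewrite !inE eqxx ?orbT.
  have eq'z : e q' z by rewrite sym.
  have dq' := cubic eq'z.
  have [r' [uq' hq']] := nbr3_2 eqy' eq'z yz dq'.
  have toR a : a \in [:: p; q; q'] -> a \in W -> r \in W /\ e r a.
    have [r1 r2] : r = q1 /\ r = r'.
      move: eqr eq'r; rewrite hq hq' !inE ![r == x]eq_sym ![r == y]eq_sym.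
      by rewrite (negPf xr) (negPf yr) (negPf rz) => /eqP -> /eqP.
    move=> ha aW; have [b bW eab] := mim_partner mW aW.
    suff E : b = r by rewrite -E sym.
    move: ha eab; rewrite !inE => /or3P [] /eqP ->; rewrite ?hp ?hq ?hq' !inE => /or3P [] /eqP E //; subst b => //;
    by rewrite ?bW // in nx ny nz; rewrite r1 || rewrite r2.
  have uniq_nbr a b : a \in [:: p; q; q'] -> b \in [:: p; q; q'] -> a \in W -> b \in W -> a = b.
    move=> ha hb aW bW; have [rW era] := toR a ha aW; have [_ erb] := toR b hb bW.
    exact: (mim_inj mW rW).
  have two c d d' : e v c -> (forall w, e c w = (w \in [:: v; d; d'])) -> d \in W \/ d' \in W.
    move=> evc hc; have [w wW] := mim_dom mW evc; rewrite hv hc !inE.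
    case/orP => /or3P [] /eqP E; subst w; by [left|right|rewrite wW in nv|rewrite wW in nx|rewrite wW in ny|rewrite wW in nz].
  have P3 := mem_head p [:: q; q'].
  have Q3 : q \in [:: p; q; q'] by rewrite !inE eqxx orbT.
  have Q3' : q' \in [:: p; q; q'] by rewrite !inE eqxx !orbT.
  have := two x p q evx hx; have := two y p q' evy hy; have := two z q q' evz hz.
  move=> [qW|qW] [pW|pW] [aW|aW]; first [
    by have /eqP := uniq_nbr _ _ P3 Q3 pW qW; rewrite (negPf pq) |
    by have /eqP := uniq_nbr _ _ P3 Q3' pW qW; rewrite (negPf pq') |
    by have /eqP := uniq_nbr _ _ P3 Q3 aW qW; rewrite (negPf pq) |
    by have /eqP := uniq_nbr _ _ P3 Q3' aW qW; rewrite (negPf pq') |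
    by have /eqP := uniq_nbr _ _ Q3 Q3' qW pW; rewrite (negPf qq') |
    by have /eqP := uniq_nbr _ _ Q3 Q3' aW pW; rewrite (negPf qq') |
    by have /eqP := uniq_nbr _ _ Q3 Q3' aW qW; rewrite (negPf qq') ].
move: b1 b2 b3 b4 gyp gyq gzq gs; rewrite b5 !tE.
move: (gam _ y _) (gam _ y _) (gam _ z _) (gam _ z _) (rho _) (rho _) (rho _) (rho _).
by move=> *; lra.
Qed.
End Square.

(** The implications assumed by [cubic_twins] and [cubic_square] hold after exchanging [p] with [q],
    or [x] with [y], if necessary. *)
Lemma cubic_bound v : (0 < dg v)%N -> rho [::] <= 1.
Proof.
move=> dv0.
have swm a b c u : (forall z, e u z = (z \in [:: a; b; c])) ->
    forall z, e u z = (z \in [:: a; c; b]).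
  by move=> h z; rewrite h !inE [(z == b) || _]orbC.
have swm' a b c u : (forall z, e u z = (z \in [:: a; b; c])) ->
    forall z, e u z = (z \in [:: b; a; c]).
  by move=> h z; rewrite h !inE !orbA [(z == a) || _]orbC.
have swu (a b c : V) : uniq [:: a; b; c] -> uniq [:: a; c; b].
  by rewrite /= !inE !negb_or [c == b]eq_sym => /and3P [/andP [-> ->] -> _].
have swu' (a b c : V) : uniq [:: a; b; c] -> uniq [:: b; a; c].
  by rewrite /= !inE !negb_or [b == a]eq_sym => /and3P [/andP [-> ->] -> _].
case: (boolP [exists a, exists b, exists c, [&& e a c, a != b & nb a == nb b]]).
  move=> /existsP [x /existsP [y /existsP [w /and3P [exw xy /eqP txy]]]].
  have ewx : e w x by rewrite sym.
  have ewy : e w y by rewrite sym -(nbr_eq _ txy).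
  have [z [uw hw]] := nbr3_2 ewx ewy xy (cubic ewx).
  have [p [q [ux hx]]] := nbr3_1 exw (cubic exw).
  have hy u : e y u = (u \in [:: w; p; q]) by rewrite -(nbr_eq _ txy) hx.
  case: (boolP (e z q ==> e z p)) => [/implyP h|]; first exact: (cubic_twins uw hw ux hx hy).
  rewrite negb_imply => /andP [_ /negbTE nzp].
  apply: (cubic_twins uw hw (swu _ _ _ ux) (swm _ _ _ _ hx) (swm _ _ _ _ hy)).
  by rewrite nzp.
move=> ntw; have no_twins a b c : e a c -> nb a = nb b -> a = b.
  move=> eac tab; apply/eqP; apply: contraNT ntw => ab.
  by apply/existsP; exists a; apply/existsP; exists b; apply/existsP; exists c; rewrite eac ab tab eqxx.
case: (boolP [exists a, exists b, exists c, exists d,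
    [&& a != c, b != d, e a b, e c b & e a d && e c d]]).
  move=> /existsP [w /existsP [x /existsP [p /existsP [y]]]].
  move=> /and5P [wp xy ewx epx /andP [ewy epy]].
  have exw : e x w by rewrite sym. have exp : e x p by rewrite sym.
  have eyw : e y w by rewrite sym. have eyp : e y p by rewrite sym.
  have [z [uw hw]] := nbr3_2 ewx ewy xy (cubic ewx).
  have [r [up hp]] := nbr3_2 epx epy xy (cubic epx).
  have [q [ux hx]] := nbr3_2 exw exp wp (cubic exw).
  have [q' [uy hy]] := nbr3_2 eyw eyp wp (cubic eyw).
  case: (boolP ((e z q' ==> e z q) && (e z q' ==> e q r ==> e q' r))) => [/andP [/implyP h1 /implyP h2]|h].
    by apply: (cubic_square no_twins wp uw hw up hp ux hx uy hy h1) => a; apply: implyP (h2 a).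
  apply: (cubic_square no_twins wp (swu' _ _ _ uw) (swm' _ _ _ _ hw) (swu' _ _ _ up)
    (swm' _ _ _ _ hp) uy hy ux hx);
  by move: h; case: (e z q); case: (e z q'); case: (e q r); case: (e q' r).
move=> nsq; apply: (cubic_no_square dv0) => a b c d ac eab ecb ead ecd.
apply/eqP; apply: contraNT nsq => bd.
apply/existsP; exists a; apply/existsP; exists b; apply/existsP; exists c.
by apply/existsP; exists d; rewrite ac bd eab ecb ead ecd.
Qed.

End Cubic.

Lemma separated_bound : rho [::] <= 1.
Proof.
case: (set_0Vmem (active e)) => [A0|[v]].
  rewrite rho_nil A0 cards0 mulr1 (_ : 1 = 1%:R) // ler_nat.
  rewrite -(cards1 (set0 : {set V})); apply/subset_leq_card/subsetP => W mW.
  rewrite inE; apply/eqP/setP => x; rewrite [RHS]inE; apply/negP => xW.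
  have [y yW exy] := mim_partner mW xW.
  by have := edge_deg exy; rewrite deg_gt0 A0 inE.
rewrite -deg_gt0 => dv.
case: (boolP [exists u, dg u == 1%N]) => [/existsP [u /eqP du]|n1].
  exact: (deg1_bound du).
have d2 x y : e x y -> (1 < dg x)%N.
  move=> exy; rewrite ltn_neqAle (edge_deg exy) andbT eq_sym.
  by apply: contraNneq n1 => dx; apply/existsP; exists x; rewrite dx.
case: (boolP [exists u, dg u == 2%N]) => [/existsP [u /eqP du]|n2].
  exact: (min_deg2_bound d2 du).
have d3 x y : e x y -> (2 < dg x)%N.
  move=> exy; rewrite ltn_neqAle (d2 x y exy) andbT eq_sym.
  by apply: contraNneq n2 => dx; apply/existsP; exists x; rewrite dx.
case: (boolP [exists u, exists w, [&& e u w, dg u == 3%N & (3 < dg w)%N]]) => [|n34].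
  move=> /existsP [u /existsP [w /and3P [euw /eqP du dw]]].
  exact: (deg3_next_to_deg4 d3 euw du dw).
case: (boolP [exists u, 3 < dg u]%N) => [/existsP [u du]|n4].
  apply: (deg4_nbrs_deg4 du) => w euw; rewrite ltn_neqAle (d3 w u) 1?sym // andbT eq_sym.
  apply: contraNneq n34 => dw; apply/existsP; exists w; apply/existsP; exists u.
  by rewrite dw du sym euw.
apply: (@cubic_bound _ v) => // x y exy; apply/eqP; rewrite eqn_leq (d3 x y exy) andbT.
by rewrite leqNgt; apply: contraNN n4 => dx; apply/existsP; exists x.
Qed.

End Core.

(** * The induction *)

Section Bound.
Variables (R : realFieldType) (t : R).
Hypotheses (t_gt0 : 0 < t) (t3 : t ^+ 3 = 3^-1).

(** Lexicographic induction on the number of active vertices and the number of twin classes: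
    branching lowers the first, merging lowers the second without raising the first. *)
Theorem card_mims_bound (V : finType) (e : rel V) : trifree e ->
  #|mims e|%:R * t ^+ #|active e| <= 1.
Proof.
have [n] := ubnP #|active e|; elim: n e => // n IHn e.
have [m] := ubnP (twin_classes e); elim: m e => // m IHm e hm hn ge.
case: (separated_or_merge ge) => [sep|[e' [ge' ha hc hf]]].
  rewrite -rho_nil; apply: separated_bound => // e' ge' lt; apply: IHn => //.
  exact: leq_trans lt hn.
have := IHm e' (leq_trans hc hm) (leq_ltn_trans ha hn) ge'.
apply: le_trans; apply: ler_pM => //; first exact/exprn_ge0/ltW.
  by rewrite ler_nat.
exact: (t_mono t_gt0 t3).
Qed.
End Bound.

(** * From edge sets to vertex sets *)

Section Bridge.
Variable G : sgraph.
Local Notation e := (@adj G).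

Let sym : symmetric e := @adj_sym G.

(** Inverse to [cover] between induced matchings and vertex sets inducing a 1-regular graph. *)
Definition edges_in (W : {set G}) : {set {set G}} := [set E in edges G | E \subset W].

Lemma edgesP (E : {set G}) : reflect (exists a b, e a b /\ E = [set a; b]) (E \in edges G).
Proof.
apply: (iffP imsetP) => [[[a b] + ->]|[a [b [ab ->]]]].
  by rewrite inE /= => ab; exists a, b.
by exists (a, b); rewrite ?inE.
Qed.

Lemma trifree_adj : triangle_free G -> trifree e.
Proof.
move=> tf; split=> // x y z exy eyz; apply/negP => exz.
by have := tf x y z; rewrite exy eyz exz.
Qed.

Lemma cover_edges_in W : one_regular e W -> cover (edges_in W) = W.
Proof.
move=> /one_regularP reg; apply/setP => x; apply/bigcupP/idP => [[E]|xW].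
  by move=> /setIdP [_ /subsetP sub] /sub.
have [y yW [exy _]] := reg x xW; exists [set x; y]; last by rewrite !inE eqxx.
apply/setIdP; split; first by apply/edgesP; exists x, y.
by rewrite subUset !sub1set xW yW.
Qed.

Lemma induced_edges_in W : one_regular e W -> induced_matching (edges_in W).
Proof.
move=> regW; have /one_regularP reg := regW.
apply/andP; split; last by rewrite cover_edges_in //; exact: regW.
apply/andP; split; first by apply/subsetP => E /setIdP [].
have edgeE E x : E \in edges_in W -> x \in E -> exists2 y, y \in W & e x y /\ E = [set x; y].
  move=> /setIdP [/edgesP [a [b [ab ->]]]]; rewrite subUset !sub1set => /andP [aW bW].
  rewrite !inE => /orP [] /eqP ->; first by exists b.
  by exists a => //; rewrite sym setUC.
apply/trivIsetP => E F hE hF; apply: contraR.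
rewrite -setI_eq0 => /set0Pn [x]; rewrite inE => /andP [xE xF].
have [y yW [exy ->]] := edgeE E x hE xE; have [z zW [exz ->]] := edgeE F x hF xF.
have xW : x \in W by move: hE => /setIdP [_ /subsetP]; apply.
have [w wW [_ u]] := reg x xW.
by rewrite (u y yW exy) (u z zW exz).
Qed.

Lemma induced_one_regular M : induced_matching M -> one_regular e (cover M).
Proof. by case/andP. Qed.

(** An edge inside the cover shares an endpoint with an edge of [M], and uniqueness of the partner
    identifies the two. *)
Lemma induced_edges M : induced_matching M -> edges_in (cover M) = M.
Proof.
move=> indM; have /one_regularP reg := induced_one_regular indM.
case/andP: indM => /andP [/subsetP sub tM] _.
apply/setP => E; apply/setIdP/idP => [[/edgesP [a [b [ab ->]]]]|EM]; last first.
  by split; [exact: sub | exact: bigcup_sup].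
rewrite subUset !sub1set => /andP [aC bC].
have /bigcupP [F FM aF] := aC.
have /edgesP [c [d [cd FE]]] := sub F FM.
have cdC : {subset F <= cover M} by apply/subsetP; exact: bigcup_sup.
have [w wC [_ u]] := reg a aC.
suff -> : [set a; b] = F by [].
rewrite (u b bC ab) FE; move: aF; rewrite FE !inE => /orP [] /eqP ac.
  by rewrite -[w](u d) ?ac // cdC // FE !inE eqxx orbT.
by rewrite setUC -[w](u c) ?ac // 1?sym // cdC // FE !inE eqxx.
Qed.

Lemma cover_sub (M M' : {set {set G}}) : M \subset M' -> cover M \subset cover M'.
Proof.
move=> /subsetP sub; apply/subsetP => x /bigcupP [E EM xE].
by apply/bigcupP; exists E => //; exact: sub.
Qed.

Lemma edges_in_sub (W W' : {set G}) : W \subset W' -> edges_in W \subset edges_in W'.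
Proof.
move=> sub; apply/subsetP => E /setIdP [h1 h2]; apply/setIdP; split=> //.
exact: subset_trans sub.
Qed.

(** A new vertex [x] has a partner [y] in [W'], and the edge [x y] is dominated from [W]. By
    uniqueness of partners in [W'] the dominating vertex is [x] or [y], and either way [x] is in
    [W]. *)
Lemma mims_maximal (W W' : {set G}) : W \in mims e -> one_regular e W' -> W \subset W' -> W' \subset W.
Proof.
move=> mW /one_regularP reg /subsetP sub; apply/subsetP => x xW'.
apply: contraT => xW; have [y yW' [exy uy]] := reg x xW'.
have [w wW hw] := mim_dom mW exy.
have inj a b : a \in W' -> b \in W' -> e y a -> e y b -> a = b.
  by have [c _ [_ u]] := reg y yW' => aW bW /(u a aW) -> /(u b bW) ->.
have eyx : e y x by rewrite sym.
case/orP: hw => [exw|eyw].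
  have E : w = y by apply: uy => //; apply: sub.
  rewrite E in wW; have [z zW eyz] := mim_partner mW wW.
  by rewrite (inj x z xW' (sub z zW) eyx eyz) zW in xW.
by rewrite (inj x w xW' (sub w wW) eyx eyw) wW in xW.
Qed.

(** An undominated edge could be added to the matching. *)
Lemma maximal_mims M : M \in maximal_induced_matchings G -> cover M \in mims e.
Proof.
rewrite inE => /maxsetP [indM maxM]; rewrite inE induced_one_regular //=.
have regW := induced_one_regular indM; set W := cover M in regW *.
have /one_regularP reg := regW.
apply/edge_dominatingP => u v euv.
case: (boolP [exists w in W, e u w || e v w]) => [/exists_inP //|nd].
have nW w : w \in W -> e u w = false /\ e v w = false.
  move=> wW; move: nd; rewrite negb_exists_in => /forall_inP /(_ w wW).
  by rewrite negb_or => /andP [/negbTE -> /negbTE ->].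
have evu : e v u by rewrite sym.
have uW : u \notin W by apply/negP => /nW [_]; rewrite evu.
have vW : v \notin W by apply/negP => /nW []; rewrite euv.
have irr := @adj_irrefl G.
have reg' : one_regular e (W :|: [set u; v]).
  apply/one_regularP => x; rewrite !inE => /or3P [xW|/eqP ->|/eqP ->].
  - have [y yW [exy uy]] := reg x xW; exists y; first by rewrite !inE yW.
    split=> // z; rewrite !inE => /or3P [zW|/eqP ->|/eqP ->]; first exact: uy.
      by rewrite sym (nW x xW).1.
    by rewrite sym (nW x xW).2.
  - exists v; first by rewrite !inE eqxx !orbT.
    split=> // z; rewrite !inE => /or3P [zW|/eqP ->|/eqP //]; last by rewrite irr.
    by rewrite (nW z zW).1.
  - exists u; first by rewrite !inE eqxx !orbT.
    split=> // z; rewrite !inE => /or3P [zW|/eqP //|/eqP ->]; last by rewrite irr.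
    by rewrite (nW z zW).2.
have E : edges_in (W :|: [set u; v]) = M.
  apply: maxM; first exact: induced_edges_in.
  by rewrite -{1}(induced_edges indM) edges_in_sub // subsetUl.
case/negP: uW; rewrite /W -E cover_edges_in // !inE eqxx orbT //.
Qed.

Lemma mims_maximal_edges W : W \in mims e -> edges_in W \in maximal_induced_matchings G.
Proof.
move=> mW; have regW : one_regular e W by move: mW; rewrite inE => /andP [].
rewrite inE; apply/maxsetP; split; first exact: induced_edges_in.
move=> M indM sub; apply/eqP; rewrite eqEsubset sub andbT -(induced_edges indM).
apply: edges_in_sub; apply: mims_maximal mW (induced_one_regular indM) _.
by rewrite -(cover_edges_in regW) cover_sub.
Qed.

Lemma card_maximal_induced_matchings : #|maximal_induced_matchings G| = #|mims e|.
Proof.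
apply/eqP; rewrite eqn_leq; apply/andP; split.
  rewrite -(@card_in_imset _ _ (@cover G) (mem (maximal_induced_matchings G))); last first.
    move=> M M'; rewrite inE => /maxsetP [i1 _]; rewrite inE => /maxsetP [i2 _] E.
    by rewrite -(induced_edges i1) -(induced_edges i2) E.
  by apply/subset_leq_card/subsetP => _ /imsetP [M hM ->]; exact: maximal_mims.
rewrite -(@card_in_imset _ _ edges_in (mem (mims e))); last first.
  move=> W W'; rewrite inE => /andP [r1 _]; rewrite inE => /andP [r2 _] E.
  by rewrite -(cover_edges_in r1) -(cover_edges_in r2) E.
by apply/subset_leq_card/subsetP => _ /imsetP [W hW ->]; exact: mims_maximal_edges.
Qed.

End Bridge.

(** * Disjoint copies of $K_{3,3}$ *)

Section K33.
Variable k : nat.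
Local Notation H := (disjoint_copies k (complete_bipartite 3 3)).

Lemma triangle_free_K33 : triangle_free H.
Proof.
move=> [i x] [j y] [l z]; rewrite /= /copies_adj /=.
by case: x => a; case: y => b; case: z => c; rewrite /= !(andbF, andbT).
Qed.

Lemma card_K33 : #|H| = (k * 6)%N.
Proof. by rewrite /= card_prod card_sum !card_ord. Qed.

(** [F] selects one edge in each copy, given by its endpoint on either side. *)
Definition K33_matching (F : {ffun 'I_k -> 'I_3 * 'I_3}) : {set H} :=
  [set u : H | match u.2 with inl a => a == (F u.1).1 | inr b => b == (F u.1).2 end].

Lemma K33_matching_mim F : K33_matching F \in mims (@adj H).
Proof.
apply/mimsP; split.
  move=> [i [a|b]]; rewrite inE /= => /eqP ->.
    exists (i, inr (F i).2); first by rewrite inE /=.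
    rewrite /= /copies_adj /= eqxx; split=> // -[j [c|d]]; rewrite inE /= => /eqP ->.
      by rewrite andbF.
    by rewrite andbT => /eqP ->.
  exists (i, inl (F i).1); first by rewrite inE /=.
  rewrite /= /copies_adj /= eqxx; split=> // -[j [c|d]]; rewrite inE /= => /eqP ->.
    by rewrite andbT => /eqP ->.
  by rewrite andbF.
move=> [i [a|b]] [j [c|d]] /=; rewrite /copies_adj /= ?andbF ?andbT // => /eqP ->.
  by exists (j, inr (F j).2); rewrite ?inE //= eqxx.
by exists (j, inr (F j).2); rewrite ?inE //= eqxx.
Qed.

Lemma K33_matching_inj : injective K33_matching.
Proof.
move=> F F' E; apply/ffunP => i.
have h1 := erefl ((i, inl (F i).1) \in K33_matching F).
have h2 := erefl ((i, inr (F i).2) \in K33_matching F).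
rewrite {2}E !inE /= eqxx in h1; rewrite {2}E !inE /= eqxx in h2.
move/esym/eqP: h1; move/esym/eqP: h2; case: (F i) (F' i) => a b [c d] /= -> ->.
by [].
Qed.

(** Nine independent choices in each copy; the general upper bound turns this into an equality. *)
Lemma card_mims_K33 : (9 ^ k <= #|mims (@adj H)|)%N.
Proof.
rewrite (_ : 9 ^ k = #|{ffun 'I_k -> 'I_3 * 'I_3}|)%N; last first.
  by rewrite card_ffun card_prod !card_ord.
rewrite -cardsT -(card_imset _ K33_matching_inj).
by apply/subset_leq_card/subsetP => _ /imsetP [F _ ->]; exact: K33_matching_mim.
Qed.
End K33.

Lemma card_mims_bij (V V' : finType) (e : rel V) (e' : rel V') (g : V -> V') :
  bijective g -> (forall x y, e' (g x) (g y) = e x y) -> (#|mims e'| <= #|mims e|)%N.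
Proof.
move=> bg mono; have [h gK hK] := bg.
have inj : injective (fun W : {set V'} => g @^-1: W).
  move=> W W' /setP E; apply/setP => y.
  by have := E (h y); rewrite !inE hK.
rewrite -(card_imset _ inj).
apply/subset_leq_card/subsetP => _ /imsetP [W mW ->]; exact: mims_preim mW.
Qed.

Theorem theorem1 (R : realType) :
  (forall G : sgraph, triangle_free G ->
     #|maximal_induced_matchings G|%:R <= (3 : R) `^ (#|G|%:R / 3)) /\
  (forall (G : sgraph) (k : nat),
     isomorphic G (disjoint_copies k (complete_bipartite 3 3)) ->
     triangle_free G /\
     #|maximal_induced_matchings G|%:R = (3 : R) `^ (#|G|%:R / 3)).
Proof.
have T0 : 0 < (3 : R) `^ 3^-1 by apply: powR_gt0; lra.
have T3 : ((3 : R) `^ 3^-1) ^+ 3 = 3.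
  by rewrite -powR_mulrn ?powR_ge0 // -powRrM mulVf ?powRr1 //; lra.
have TE n : (3 : R) `^ (n%:R / 3) = ((3 : R) `^ 3^-1) ^+ n.
  by rewrite -powR_mulrn ?powR_ge0 // -powRrM mulrC.
have upper (G : sgraph) : triangle_free G ->
    #|maximal_induced_matchings G|%:R <= (3 : R) `^ (#|G|%:R / 3).
  move=> tf; rewrite TE card_maximal_induced_matchings.
  have t0 : 0 < ((3 : R) `^ 3^-1)^-1 by rewrite invr_gt0.
  have t3 : (((3 : R) `^ 3^-1)^-1) ^+ 3 = 3^-1 by rewrite exprVn T3.
  have := card_mims_bound t0 t3 (trifree_adj tf).
  rewrite exprVn ler_pdivrMr ?exprn_gt0 // mul1r => /le_trans; apply.
  (* Passing from active vertices to all vertices requires a base of at least 1, which follows from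
     its cube being 3. *)
  apply: ler_weXn2l; last exact: max_card.
  rewrite leNgt; apply/negP => lt1.
  have : ((3 : R) `^ 3^-1) ^+ 3 <= 1 by apply: exprn_ile1; apply: ltW.
  by rewrite T3; lra.
split=> // G k [g bg mono].
have tf : triangle_free G.
  by move=> x y z; rewrite -!mono; apply: triangle_free_K33.
split=> //; apply/eqP; rewrite eq_le upper //= TE.
rewrite (bij_eq_card bg) card_K33 mulnC (exprM _ 6) (exprM _ 3 2) T3.
have -> : (3 : R) ^+ 2 = 9%:R by ring.
rewrite -natrX ler_nat card_maximal_induced_matchings.
exact: leq_trans (card_mims_K33 k) (card_mims_bij bg mono).
Qed.
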